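(* Let $f$ be an error density, $\pi$ a prior distribution and $\{(\mathbf{x}_i,y_i)\}_{i=1}^n$ data indexed by $\omega$, as described in the context, and suppose the following three assumptions hold. (A1) The probability density function $f$ on $\mathbb{R}$ satisfies: $f(y)>0$ and $f(y)=f(|y|)$ for all $y\in\mathbb{R}$; $f(|y_2|)\le f(|y_1|)$ whenever $|y_2|\ge|y_1|$; there is a constant $C>0$ with $f\le C$; and either (i) (regularly varying case) there are constants $C_f>0$ and $\alpha>0$ with $\lim_{y\to\pm\infty} f(y)/\big(C_f|y|^{-(\alpha+1)}\big)=1$, or (ii) (log-regularly varying case) there are constants $C_f>0$ and $\alpha>0$ with $\lim_{y\to\pm\infty} f(y)/\big(C_f|y|^{-1}(\log|y|)^{-(\alpha+1)}\big)=1$. (A2') Under the prior $\pi$ of $(\boldsymbol\beta,\sigma)\in\mathbb{R}^p\times(0,\infty)$, $\boldsymbol\beta$ and $\sigma$ are independent; $\sigma^2$ has finite inverse moments, that is $\mathbb{E}[(\sigma^2)^{-\kappa}]<\infty$ for every $\kappa>0$; and the components $\beta_1,\dots,\beta_p$ of $\boldsymbol\beta$ are independent, each $\beta_j$ having a sub-exponential distribution (not necessarily centred, and not necessarily the same for all $j$). (A3) In case (i), $|\mathrm{O}^{\mathsf c}|>\alpha|\mathrm{O}|$; in case (ii), $|\mathrm{O}^{\mathsf c}|\ge|\mathrm{O}|$. Then, as $\omega\to\infty$: (a) $m_\omega(\mathbf{y})\big/\prod_{i\in\mathrm{O}}f(y_i)\to m(\mathbf{y}_{\mathrm{O}^{\mathsf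 c}})$; (b) for every $\boldsymbol\beta\in\mathbb{R}^p$ and $\sigma>0$, $\pi_\omega(\boldsymbol\beta,\sigma\mid\mathbf{y})\to\pi(\boldsymbol\beta,\sigma\mid\mathbf{y}_{\mathrm{O}^{\mathsf c}})$; (c) the posterior distribution $\pi_\omega(\cdot,\cdot\mid\mathbf{y})$ converges in distribution to $\pi(\cdot,\cdot\mid\mathbf{y}_{\mathrm{O}^{\mathsf c}})$.
   Context: Let $n,p\ge1$ be integers and $\mathbf{x}_1,\dots,\mathbf{x}_n\in\mathbb{R}^p$ fixed vectors. Linear regression model: $Y_i=\mathbf{x}_i^T\boldsymbol\beta+\sigma\varepsilon_i$, $i=1,\dots,n$, where $\boldsymbol\beta\in\mathbb{R}^p$, $\sigma>0$, the errors $\varepsilon_1,\dots,\varepsilon_n$ are i.i.d. with density $f$ and independent of $(\boldsymbol\beta,\sigma)$. Data indexed by $\omega>0$: for each $i$, $y_i\in\mathbb{R}$ has a fixed sign (not depending on $\omega$) and $|y_i|=a_i+b_i\omega$, where $a_i>0$ is a constant and $b_i$ is a constant with $b_i=0$ (non-outlier) or $b_i\ge1$ (outlier). Put $\mathbf{y}=(y_1,\dots,y_n)^T$, $\mathrm{O}=\{i:b_i\ge1\}$, $\mathrm{O}^{\mathsf c}=\{1,\dots,n\}\setminus\mathrm{O}$, $\mathbf{y}_{\mathrm{O}^{\mathsf c}}=\{y_i:i\in\mathrm{O}^{\mathsf c}\}$; $|\mathrm{O}|$ and $|\mathrm{O}^{\mathsf c}|$ denote cardinalities. Let $g(\sigma)=\sigma^\alpha$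 if $f$ is regularly varying (case (i)) and $g(\sigma)=1$ if $f$ is log-regularly varying (case (ii)). The prior is assumed to have a density, written $\pi(\boldsymbol\beta,\sigma)$, on $\mathbb{R}^p\times(0,\infty)$. Define $$m_\omega(\mathbf{y})=\int_{\mathbb{R}^p}\int_0^\infty\pi(\boldsymbol\beta,\sigma)\prod_{i=1}^n\frac1\sigma f\Big(\frac{y_i-\mathbf{x}_i^T\boldsymbol\beta}{\sigma}\Big)\,d\sigma\,d\boldsymbol\beta,$$ $$m(\mathbf{y}_{\mathrm{O}^{\mathsf c}})=\int_{\mathbb{R}^p}\int_0^\infty\pi(\boldsymbol\beta,\sigma)\,g(\sigma)^{|\mathrm{O}|}\prod_{i\in\mathrm{O}^{\mathsf c}}\frac1\sigma f\Big(\frac{y_i-\mathbf{x}_i^T\boldsymbol\beta}{\sigma}\Big)\,d\sigma\,d\boldsymbol\beta,$$ and, these constants being finite under the hypotheses, the probability densities on $\mathbb{R}^p\times(0,\infty)$ (and the associated distributions, denoted the same way) $$\pi_\omega(\boldsymbol\beta,\sigma\mid\mathbf{y})=\frac{\pi(\boldsymbol\beta,\sigma)\prod_{i=1}^n\frac1\sigma f\big(\frac{y_i-\mathbf{x}_i^T\boldsymbol\beta}{\sigma}\big)}{m_\omega(\mathbf{y})},\qquad \pi(\boldsymbol\beta,\sigma\mid\mathbf{y}_{\mathrm{O}^{\mathsf c}})=\frac{\pi(\boldsymbol\beta,\sigma)\,g(\sigma)^{|\mathrm{O}|}\prod_{i\in\mathrm{O}^{\mathsf c}}\frac1\sigma f\big(\frac{y_i-\mathbf{x}_i^T\boldsymbol\beta}{\sigma}\big)}{m(\mathbf{y}_{\mathrm{O}^{\mathsf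 c}})}.$$ A real random variable $X$ is sub-exponential if its sub-exponential norm $\|X\|_{\psi_1}=\inf\{t>0:\mathbb{E}[\exp(|X|/t)]\le2\}$ is finite. *)

(* Defs.v *)
From HB Require Import structures.
From mathcomp Require Import all_boot all_order all_algebra.
From mathcomp Require Import all_classical all_reals all_analysis.

Set Implicit Arguments.
Unset Strict Implicit.
Unset Printing Implicit Defensive.

Import Order.TTheory GRing.Theory Num.Theory.
Import numFieldNormedType.Exports.

Local Open Scope classical_set_scope.
Local Open Scope ring_scope.

(* R^p is the type 'cV[R]_p; its sigma-algebra is generated by the coordinate
   maps, which gives the Borel sets. *)
Definition cV_display : measure_display.
Proof. exact: default_measure_display. Qed.

Section measurable_cV.
Context {R : realType} (p : nat).

Definition cV_coord (j : 'I_p) (v : 'cV[R]_p) : R := v j 0.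

Let cV_set0 : g_sigma_preimage cV_coord set0.
Proof. exact: sigma_algebra0. Qed.

Let cV_setC A : g_sigma_preimage cV_coord A -> g_sigma_preimage cV_coord (~` A).
Proof. exact: sigma_algebraC. Qed.

Let cV_bigcup (F : (set 'cV[R]_p)^nat) :
  (forall i, g_sigma_preimage cV_coord (F i)) ->
  g_sigma_preimage cV_coord (\bigcup_i (F i)).
Proof. exact: sigma_algebra_bigcup. Qed.

HB.instance Definition _ := @isMeasurable.Build cV_display
  'cV[R]_p (g_sigma_preimage cV_coord) cV_set0 cV_setC cV_bigcup.

Lemma measurable_cV_coord (j : 'I_p) :
  measurable_fun [set: 'cV[R]_p] (cV_coord j).
Proof.
move=> _ Y mY; rewrite setTI; apply: sub_sigma_algebra => /=.
rewrite -bigcup_seq/=; exists j => /=; first by rewrite mem_index_enum.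
by exists Y => //; rewrite setTI.
Qed.

Lemma measurable_fun_cV d (T : measurableType d) (f : T -> 'cV[R]_p) :
  (forall j, measurable_fun [set: T] (cV_coord j \o f)) ->
  measurable_fun [set: T] f.
Proof.
move=> mf _ A mA; rewrite setTI.
suff H : g_sigma_preimage cV_coord `<=` [set B | measurable (f @^-1` B)].
  exact: H.
apply: smallest_sub.
  split => [|B mB|F mF] /=.
  - by rewrite preimage_set0.
  - by rewrite setTD preimage_setC; exact: measurableC.
  - by rewrite preimage_bigcup; exact: bigcupT_measurable.
move=> B; rewrite -bigcup_seq => -[j _ [Y mY <-]] /=.
rewrite setTI -comp_preimage -[X in measurable X]setTI.
exact: mf.
Qed.

End measurable_cV.

Lemma sigma_finite_product_measure d1 d2 (T1 : measurableType d1)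
    (T2 : measurableType d2) (R : realType)
    (m1 : {sigma_finite_measure set T1 -> \bar R})
    (m2 : {sigma_finite_measure set T2 -> \bar R}) :
  sigma_finite setT (m1 \x m2)%E.
Proof.
have /sigma_finiteP[F [FT ndF Foo]] := sigma_finiteT m1.
have /sigma_finiteP[G [GT ndG Goo]] := sigma_finiteT m2.
exists (fun k => F k `*` G k).
  rewrite -setXTT FT GT predeqE => -[x y]; split.
    move=> [/= [k _ Fx] [l _ Gy]]; exists (maxn k l) => //; split.
    - by move: x Fx; exact/subsetPset/ndF/leq_maxl.
    - by move: y Gy; exact/subsetPset/ndG/leq_maxr.
  by move=> [k _ []/= ? ?]; split; exists k.
move=> k; have [? ?] := Foo k; have [? ?] := Goo k.
split; first exact: measurableX.
by rewrite product_measure1E// lte_mul_pinfty// ge0_fin_numE.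
Qed.

Section lebesgue_cV.
Context {R : realType}.

Definition cV_cons p (z : R * 'cV[R]_p) : 'cV[R]_p.+1 :=
  col_mx (z.1%:M : 'cV[R]_1) z.2.

Lemma cV_cons0 p (z : R * 'cV[R]_p) : cV_cons z ord0 0 = z.1.
Proof.
have -> : ord0 = lshift p (ord0 : 'I_1) by exact: val_inj.
have := @col_mxEu R 1 p 1 (z.1%:M) z.2 ord0 0.
by rewrite /cV_cons => ->; rewrite mxE eqxx mulr1n.
Qed.

Lemma cV_consS p (z : R * 'cV[R]_p) (j : 'I_p) :
  cV_cons z (lift ord0 j) 0 = z.2 j 0.
Proof.
have -> : lift ord0 j = rshift 1 j by exact: val_inj.
exact: (@col_mxEd R 1 p 1 (z.1%:M) z.2 j 0).
Qed.

Lemma measurable_cV_cons p :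
  measurable_fun [set: measurableTypeR R * 'cV[R]_p] (@cV_cons p).
Proof.
apply: measurable_fun_cV => j.
have [->|[k ->]] : j = ord0 \/ exists k, j = lift ord0 k.
  by case: (unliftP ord0 j) => [k ->|->]; [right; exists k|left].
- rewrite (_ : _ \o _ = fst) //.
  by apply/funext => z; rewrite /= /cV_coord cV_cons0.
- rewrite (_ : _ \o _ = cV_coord k \o snd).
    by apply: measurableT_comp => //; exact: measurable_cV_coord.
  by apply/funext => z; rewrite /= /cV_coord cV_consS.
Qed.

HB.instance Definition _ p := @isMeasurableFun.Build _ _ _ _
  (@cV_cons p : measurableTypeR R * 'cV[R]_p -> 'cV[R]_p.+1)
  (@measurable_cV_cons p).

Section step.
Variables (p : nat) (m : {sigma_finite_measure set 'cV[R]_p -> \bar R}).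

Definition lebesgue_cV_step : set 'cV[R]_p.+1 -> \bar R :=
  pushforward (lebesgue_measure \x m)%E
    (@cV_cons p : measurableTypeR R * 'cV[R]_p -> 'cV[R]_p.+1).

Let step0 : lebesgue_cV_step set0 = 0%E.
Proof. exact: measure0. Qed.

Let step_ge0 A : (0 <= lebesgue_cV_step A)%E.
Proof. exact: measure_ge0. Qed.

Let step_sigma_additive : semi_sigma_additive lebesgue_cV_step.
Proof. exact: measure_semi_sigma_additive. Qed.

HB.instance Definition _ := isMeasure.Build _ _ _ lebesgue_cV_step
  step0 step_ge0 step_sigma_additive.

Let lebesgue_cV_step_sigma_finite : sigma_finite setT lebesgue_cV_step.
Proof.
pose unc (v : 'cV[R]_p.+1) : measurableTypeR R * 'cV[R]_p :=
  (v ord0 0, \col_j v (lift ord0 j) 0).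
have uncK : cancel (@cV_cons p) unc.
  move=> [x v]; rewrite /unc cV_cons0; congr pair.
  by apply/colP => j; rewrite mxE cV_consS.
have munc : measurable_fun [set: 'cV[R]_p.+1] unc.
  apply/measurable_fun_pairP; split.
    exact: (@measurable_cV_coord R p.+1 ord0).
  apply: measurable_fun_cV => j.
  rewrite (_ : _ \o _ = cV_coord (lift ord0 j)); first exact: measurable_cV_coord.
  by apply/funext => v; rewrite /= /cV_coord mxE.
have [F FT Foo] := sigma_finite_product_measure
  (@lebesgue_measure R : {sigma_finite_measure set _ -> \bar R}) m.
exists (fun k => unc @^-1` (F k)).
  by rewrite -preimage_bigcup -FT preimage_setT.
move=> k; have [mF Fk] := Foo k; split.
  by rewrite -[X in measurable X]setTI; exact: munc.
rewrite /lebesgue_cV_step /pushforward -comp_preimage.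
by rewrite (_ : unc \o _ = id) ?preimage_id//; apply/funext => z; exact: uncK.
Qed.

HB.instance Definition _ := Measure_isSigmaFinite.Build _ _ _
  lebesgue_cV_step lebesgue_cV_step_sigma_finite.

End step.

(* R^0 is a point, with mass 1, and R^(p+1) = R x R^p. *)
Fixpoint lebesgue_cV p : {sigma_finite_measure set 'cV[R]_p -> \bar R} :=
  match p with
  | 0 => \d_(0 : 'cV[R]_0)
  | p'.+1 => lebesgue_cV_step (lebesgue_cV p')
  end.

Lemma lebesgue_cV_box p (A : 'I_p -> set R) :
  (forall j, measurable (A j)) ->
  lebesgue_cV p [set v | forall j, A j (v j 0)] =
  (\prod_j lebesgue_measure (A j))%E.
Proof.
elim: p A => [|p IH] A mA.
  by rewrite big_ord0 /= diracE mem_set// => -[].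
rewrite big_ord_recl -IH//.
rewrite -(@product_measure1E _ _ _ _ R lebesgue_measure (lebesgue_cV p))//.
- rewrite /= /lebesgue_cV_step /pushforward; congr (_ _).
  apply/seteqP; split => -[x v] /= H.
  + split; first by rewrite -[x](cV_cons0 (x, v)).
    by move=> j; rewrite -(cV_consS (x, v)).
  + move=> j; case: (unliftP ord0 j) => [k ->|->].
      by rewrite cV_consS; exact: H.2.
    by rewrite cV_cons0; exact: H.1.
- exact: mA.
- rewrite [X in measurable X](_ : _ =
    \bigcap_(j in [set: 'I_p]) (cV_coord j @^-1` A (lift ord0 j))).
    apply: fin_bigcap_measurable => [|j _]; first exact: finite_finset.
    by rewrite -[X in measurable X]setTI; exact: measurable_cV_coord.
  by apply/seteqP; split => v /= H; [move=> j _|move=> j]; exact: H.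
Qed.

End lebesgue_cV.

Definition param_space (R : realType) (p : nat) : set ('cV[R]_p * R) :=
  [set z | 0 < z.2].
Arguments param_space {R} p _.

(* lebesgue_measure lives on measurableTypeR R, a copy of R: sigma ranges over
   that copy wherever measures are involved. *)
Definition lebesgue_param (R : realType) (p : nat) :
    set ('cV[R]_p * measurableTypeR R) -> \bar R :=
  (lebesgue_cV p \x lebesgue_measure)%E.

Arguments lebesgue_param {R} p _.

HB.instance Definition _ (R : realType) (p : nat) :=
  Measure.on (@lebesgue_param R p).

Definition param_mass (R : realType) (p : nat) (q : 'cV[R]_p * R -> R) : \bar R :=
  (\int[lebesgue_param p]_(z in param_space p) (q z)%:E)%E.

Definition param_law (R : realType) (p : nat) (q : 'cV[R]_p * R -> R) :
    set ('cV[R]_p * measurableTypeR R) -> \bar R :=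
  fun B => (\int[lebesgue_param p]_(z in B `&` param_space p) (q z)%:E)%E.

(* q divided by its mass; meaningful when 0 < param_mass q < +oo *)
Definition normalized (R : realType) (p : nat) (q : 'cV[R]_p * R -> R)
    (z : 'cV[R]_p * R) : R :=
  q z / fine (param_mass q).

(* Convergence in distribution on the metric space R^p x (0, +oo): the test
   functions need only be continuous on that open set. *)
Definition cvg_in_distribution (R : realType) (p : nat)
    (mu : R -> set ('cV[R]_p * measurableTypeR R) -> \bar R)
    (nu : set ('cV[R]_p * measurableTypeR R) -> \bar R) : Prop :=
  forall h : 'cV[R]_p * R -> R,
    {within param_space p, continuous h} ->
    (exists M : R, forall z, param_space p z -> `|h z| <= M) ->
    (\int[mu w]_(z in param_space p) (h z)%:E)%E @[w --> +oo] -->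
    (\int[nu]_(z in param_space p) (h z)%:E)%E.

Definition independent2 d d1 d2 (T : measurableType d) (T1 : measurableType d1)
    (T2 : measurableType d2) (R : realType) (P : probability T R)
    (X : T -> T1) (Y : T -> T2) : Prop :=
  forall A B, measurable A -> measurable B ->
    P (X @^-1` A `&` Y @^-1` B) = (P (X @^-1` A) * P (Y @^-1` B))%E.

Definition mutually_independent d d' (T : measurableType d)
    (T' : measurableType d') (R : realType) (P : probability T R) (p : nat)
    (X : 'I_p -> T -> T') : Prop :=
  forall (J : {set 'I_p}) (A : 'I_p -> set T'), (forall j, measurable (A j)) ->
    P (\bigcap_(j in [set j | j \in J]) (X j @^-1` A j)) =
    (\prod_(j in J) P (X j @^-1` A j))%E.

Definition psi1_norm d (T : measurableType d) (R : realType)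
    (P : probability T R) (X : T -> R) : \bar R :=
  ereal_inf [set t%:E | t in
    [set t : R | 0 < t /\ ('E_P[fun u => (expR (`|X u| / t))%R] <= 2%:E)%E]].

Definition sub_exponential d (T : measurableType d) (R : realType)
    (P : probability T R) (X : T -> R) : Prop :=
  (psi1_norm P X < +oo)%E.

Definition is_density (R : realType) (f : R -> R) : Prop :=
  [/\ measurable_fun [set: R] f, forall y, 0 <= f y &
      (\int[lebesgue_measure]_y (f y)%:E = 1)%E].

Variant tail_case := RegularlyVarying | LogRegularlyVarying.

Definition tail_shape (R : realType) (c : tail_case) (alpha y : R) : R :=
  match c with
  | RegularlyVarying => `|y| `^ (- (alpha + 1))
  | LogRegularlyVarying => `|y|^-1 * ln `|y| `^ (- (alpha + 1))
  end.

Definition error_assumption (R : realType) (f : R -> R) (c : tail_case)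
    (alpha : R) : Prop :=
  [/\ forall y, 0 < f y /\ f y = f `|y|,
      forall y1 y2 : R, `|y1| <= `|y2| -> f `|y2| <= f `|y1|,
      exists2 C : R, 0 < C & forall y, f y <= C &
      0 < alpha /\ exists2 Cf : R, 0 < Cf &
        (f y / (Cf * tail_shape c alpha y) @[y --> +oo] --> (1 : R)) /\
        (f y / (Cf * tail_shape c alpha y) @[y --> -oo] --> (1 : R))].

(* The factor g(sigma) that each outlier leaves in the limiting posterior. *)
Definition outlier_weight (R : realType) (c : tail_case) (alpha sigma : R) : R :=
  match c with
  | RegularlyVarying => sigma `^ alpha
  | LogRegularlyVarying => 1
  end.

Definition outlier_proportion (R : realType) (c : tail_case) (alpha : R)
    (n : nat) (out : {set 'I_n}) : Prop :=
  match c with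
  | RegularlyVarying => alpha * #|out|%:R < #|~: out|%:R
  | LogRegularlyVarying => (#|out| <= #|~: out|)%N
  end.

Definition prior_density (R : realType) (p : nat)
    (Pi : probability ('cV[R]_p * measurableTypeR R)%type R)
    (prior : 'cV[R]_p * R -> R) : Prop :=
  [/\ measurable_fun (param_space p) prior,
      forall z, param_space p z -> 0 <= prior z &
      forall B, measurable B -> Pi B = param_law prior B].

Definition prior_assumption (R : realType) (p : nat)
    (Pi : probability ('cV[R]_p * measurableTypeR R)%type R) : Prop :=
  let beta (z : 'cV[R]_p * R) : 'cV[R]_p := z.1 in
  let sigma (z : 'cV[R]_p * R) : R := z.2 in
  [/\ independent2 Pi beta sigma,
      forall kappa : R, 0 < kappa ->
        ('E_Pi[fun z => ((sigma z ^+ 2) `^ (- kappa))%R] < +oo)%E,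
      mutually_independent Pi (fun (j : 'I_p) z => beta z j 0) &
      forall j : 'I_p, sub_exponential Pi (fun z => beta z j 0)].

(* The i-th response has absolute value a i + b i * omega and a sign that does
   not depend on omega: sgn i tells whether it is negative. *)
Definition response (R : realType) (n : nat) (sgn : 'I_n -> bool)
    (a b : 'I_n -> R) (omega : R) (i : 'I_n) : R :=
  (-1) ^+ sgn i * (a i + b i * omega).

(* Value of response for i with b i = 0, whatever omega is. *)
Definition fixed_response (R : realType) (n : nat) (sgn : 'I_n -> bool)
    (a : 'I_n -> R) (i : 'I_n) : R :=
  (-1) ^+ sgn i * a i.

Definition outliers (R : realType) (n : nat) (b : 'I_n -> R) : {set 'I_n} :=
  [set i | 1 <= b i]%SET.

Definition likelihood (R : realType) (n p : nat) (x : 'I_n -> 'cV[R]_p)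
    (f : R -> R) (y : 'I_n -> R) (J : {set 'I_n}) (z : 'cV[R]_p * R) : R :=
  \prod_(i in J) (z.2^-1 * f ((y i - ((x i)^T *m z.1) 0 0) / z.2)).

Definition posterior_kernel (R : realType) (n p : nat) (x : 'I_n -> 'cV[R]_p)
    (f : R -> R) (prior : 'cV[R]_p * R -> R) (y : 'I_n -> R)
    (z : 'cV[R]_p * R) : R :=
  prior z * likelihood x f y [set: 'I_n]%SET z.

Definition limit_kernel (R : realType) (n p : nat) (x : 'I_n -> 'cV[R]_p)
    (f : R -> R) (prior : 'cV[R]_p * R -> R) (c : tail_case) (alpha : R)
    (out : {set 'I_n}) (y : 'I_n -> R) (z : 'cV[R]_p * R) : R :=
  prior z * outlier_weight c alpha z.2 ^+ #|out| * likelihood x f y (~: out) z.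

(* Main.v *)
Require Import Defs.
From HB Require Import structures.
From mathcomp Require Import all_boot all_order all_algebra.
From mathcomp Require Import all_classical all_reals all_analysis.
From mathcomp Require Import measurable_realfun.
From mathcomp Require Import ring lra.

Set Implicit Arguments.
Unset Strict Implicit.
Unset Printing Implicit Defensive.

Import Order.TTheory GRing.Theory Num.Theory.
Import numFieldNormedType.Exports.

Local Open Scope classical_set_scope.
Local Open Scope ring_scope.

(* Dominated convergence with respect to the prior.  Divided by the outlier
   densities, the likelihood gets from each outlier [y] a factor
   [f ((y - mu) / s) / (s * f y)], which tends to [g s] since the tail of [f] is
   (log-)regularly varying.  Uniformly in large [|y|], this factor is at most a
   constant times [max 1 s ^ d * max 1 s^-1 * (1 + |mu|) ^ m], with [d = alpha]
   or [d = 1]: for [|mu| <= |y| / 2] it is compared with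
   [f (y / (2 s)) / (s * f y)], and otherwise [1 / f y] is polynomially bounded
   in [|mu|].  The bound on the number of outliers says that [d * |O| <= |O^c|],
   so the factors [s^-1] of the non-outliers absorb the growth in large [s], and
   what remains is an inverse power of [min 1 s] times a polynomial in [beta].
   This is integrable under the prior, because [sigma] has all inverse moments
   and sub-exponential variables have all moments. *)

(** * Tail of the error density *)

Section tail_profile.
Variables (R : realType) (c : tail_case) (alpha : R).
Hypothesis alpha_gt0 : 0 < alpha.

(* [y * tail_shape c alpha y], with the logarithm truncated so that the profile
   is positive and antitone on the whole half-line. *)
Definition tail_profile (z : R) : R :=
  match c with
  | RegularlyVarying => z `^ (- alpha)
  | LogRegularlyVarying => ln (Num.max z (expR 1)) `^ (- (alpha + 1))
  end.

(** In the log-regular case the true growth in [s] is only a power of a logarithm; 1 is the largest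
    exponent that [#|out| <= #|~: out|] can absorb. *)
Definition tail_growth : R :=
  match c with RegularlyVarying => alpha | LogRegularlyVarying => 1 end.

Let lnmax_ge1 (z : R) : 1 <= ln (Num.max z (expR 1)).
Proof.
rewrite -[leLHS](expRK (1 : R)) ler_ln ?le_max ?lexx ?orbT// ?posrE ?expR_gt0//.
by rewrite lt_max expR_gt0 orbT.
Qed.

Lemma tail_profile_gt0 (z : R) : 0 < z -> 0 < tail_profile z.
Proof.
rewrite /tail_profile => z0; case: c; apply: powR_gt0 => //.
exact: lt_le_trans ltr01 (lnmax_ge1 z).
Qed.

Let powR_anti (r x y : R) : 0 <= r -> 0 < x -> x <= y -> y `^ (- r) <= x `^ (- r).
Proof.
move=> r0 x0 xy; rewrite !powRN lef_pV2 ?posrE ?powR_gt0//.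
  by apply: ge0_ler_powR => //; rewrite nnegrE; lra.
exact: lt_le_trans xy.
Qed.

Lemma tail_profile_anti (x y : R) : 0 < x -> x <= y -> tail_profile y <= tail_profile x.
Proof.
rewrite /tail_profile => x0 xy.
case: c; apply: powR_anti; rewrite ?addr_ge0 ?ler01 ?(ltW alpha_gt0)//.
  exact: lt_le_trans ltr01 (lnmax_ge1 x).
rewrite ler_ln ?posrE ?lt_max ?expR_gt0 ?orbT//.
by rewrite ge_max !le_max xy lexx !orbT.
Qed.

Lemma tail_shapeE (y : R) : expR 1 <= y -> tail_profile y = y * tail_shape c alpha y.
Proof.
move=> ey; have y0 : 0 < y by apply: lt_le_trans ey; exact: expR_gt0.
rewrite /tail_profile /tail_shape gtr0_norm//; case: c.
- rewrite -[X in _ = X * _](powRr1 (ltW y0)) -powRD; last by rewrite (gt_eqF y0) implybT.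
  by congr (_ `^ _); ring.
- by rewrite (max_l ey) mulrA mulfV ?mul1r// gt_eqF.
Qed.

Lemma tail_shape_gt0 (y : R) : 1 < y -> 0 < tail_shape c alpha y.
Proof.
move=> y1; have y0 : 0 < y by exact: lt_trans y1.
rewrite /tail_shape gtr0_norm//; case: c; first exact: powR_gt0.
by rewrite mulr_gt0 ?invr_gt0// powR_gt0// ln_gt0.
Qed.

Lemma tail_profile_scale : exists2 K : R, 0 < K & forall u s : R, 0 < u -> 0 < s ->
  tail_profile (u / (2 * s)) <= K * tail_profile u * Num.max 1 s `^ tail_growth.
Proof.
rewrite /tail_profile /tail_growth; case: c.
  exists (2 `^ alpha) => [|u s u0 s0]; first exact: powR_gt0.
  rewrite powRM ?invr_ge0 ?mulr_ge0 ?(ltW u0) ?(ltW s0)//.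
  rewrite -[_^-1]powR_inv1 ?mulr_ge0 ?(ltW s0)// -powRrM mulrNN mul1r.
  rewrite powRM ?(ltW s0)// mulrCA mulrA ler_wpM2l ?mulr_ge0 ?powR_ge0//.
  by apply: ge0_ler_powR; rewrite ?nnegrE ?le_max ?lexx ?ler01 ?orbT ?(ltW s0) ?ltW.
have a1 : 0 < alpha + 1 by rewrite addr_gt0.
(* With this [e], bounding a logarithm by a multiple of [m ^ e] costs [(m ^ e) ^ (alpha + 1) = m] in
   the profile, which is the announced growth exponent 1. *)
pose e := (alpha + 1)^-1; have e0 : 0 < e by rewrite invr_gt0.
have l2 : 0 <= ln (2 : R) by rewrite ln_ge0//; lra.
have e1 : 0 < e^-1 by rewrite invr_gt0.
exists ((1 + ln 2 + e^-1) `^ (alpha + 1)) => [|u s u0 s0].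
  by rewrite powR_gt0//; lra.
set A := ln (Num.max u _); set B := ln (Num.max (_ / _) _); set m := Num.max 1 s.
have m1 : 1 <= m by rewrite le_max lexx.
have A1 : 1 <= A by exact: lnmax_ge1.
have B1 : 1 <= B by exact: lnmax_ge1.
(* [ln] is subadditive, so dividing [u] by [2 s] costs at most [ln (2 m)],
   which is dominated by every positive power of [m] *)
have AB : A <= B + ln (2 * m).
  have Mp (z : R) : Num.max z (expR 1) \is Num.pos by rewrite posrE lt_max expR_gt0 orbT.
  have mp : 2 * m \is Num.pos by rewrite posrE; lra.
  rewrite -lnM ?Mp// ler_ln ?Mp//; last by rewrite posrE mulr_gt0 -?posrE ?Mp.
  have sm : s <= m by rewrite le_max lexx orbT.
  rewrite ge_max; apply/andP; split.
    apply: (@le_trans _ _ (u / (2 * s) * (2 * m))).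
      rewrite -mulrA ler_peMr ?(ltW u0)//.
      by rewrite mulrC ler_pdivlMr ?mul1r ?mulr_gt0// ler_wpM2l.
    by rewrite ler_wpM2r ?le_max ?lexx//; lra.
  apply: (@le_trans _ _ (expR 1 * (2 * m))).
    by rewrite ler_peMr ?expR_ge0//; lra.
  by rewrite ler_wpM2r ?le_max ?lexx ?orbT//; lra.
have me1 : 1 <= m `^ e by rewrite -(powRr0 m) ler_powR// ltW.
have lm : ln m <= e^-1 * m `^ e.
  rewrite -ler_pdivrMl ?invr_gt0// invrK -ln_powR.
  by apply/ltW/ln_sublinear; lra.
have ABm : A <= B * ((1 + ln 2 + e^-1) * m `^ e).
  apply: (le_trans AB); rewrite lnM ?posrE//; last by lra.
  apply: (@le_trans _ _ (B * m `^ e + (ln 2 * m `^ e + e^-1 * m `^ e))).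
    apply: lerD; first by rewrite ler_peMr//; lra.
    by apply: lerD => //; rewrite ler_peMr.
  have -> : B * ((1 + ln 2 + e^-1) * m `^ e) =
    B * m `^ e + B * (ln 2 * m `^ e + e^-1 * m `^ e) by ring.
  rewrite lerD2l ler_peMl// addr_ge0// mulr_ge0 ?powR_ge0//; lra.
have -> : m `^ 1 = (m `^ e) `^ (alpha + 1) by rewrite -powRrM mulVf ?gt_eqF.
rewrite mulrAC -powRM ?powR_ge0//; last by lra.
rewrite !powRN ler_pdivlMr ?powR_gt0//; last by lra.
rewrite mulrC ler_pdivrMr ?powR_gt0//; last by lra.
rewrite mulrC -powRM//; last 2 first.
- by lra.
- by rewrite mulr_ge0 ?powR_ge0//; lra.
by apply: ge0_ler_powR; rewrite ?nnegrE; lra.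
Qed.

(** In both cases the profile is [v ^ (- r)] with [0 < v <= u] and [r <= alpha + 1], so any integer
    above [alpha + 1] serves. This controls [1 / f u] when [mu] is comparable with [u]. *)
Lemma tail_profile_poly : exists m : nat, forall u : R, expR 1 <= u ->
  1 <= tail_profile u * u ^+ m.
Proof.
pose m := (Num.truncn (alpha + 1)).+1.
have am : alpha + 1 <= m%:R by apply/ltW/truncnS_gt.
have a0 := alpha_gt0; exists m => u eu; have u1 : 1 <= u.
  by apply: le_trans eu; rewrite (le_trans _ (expR_ge1Dx _))//; lra.
have u0 : 0 < u by lra.
suff H (v r : R) : 0 < v -> v <= u -> 0 <= r -> r <= m%:R -> 1 <= v `^ (- r) * u ^+ m.
  rewrite /tail_profile; case: c; apply: H => //; try lra.
  - exact: lt_le_trans ltr01 (lnmax_ge1 u).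
  - by rewrite max_l// ltW// ln_sublinear.
move=> v0 vu r0 rm; rewrite powRN mulrC ler_pdivlMr ?powR_gt0// mul1r.
rewrite -powR_mulrn ?(ltW u0)//; apply: (@le_trans _ _ (u `^ r)).
  by apply: ge0_ler_powR; rewrite ?nnegrE//; lra.
exact: ler_powR.
Qed.

End tail_profile.

(** Beyond [M] the quotient of [f] by its asymptotic form lies between 1/2 and 2, which gives both
    bounds. The upper one extends to [z < M] because [z * f z <= C * M] and the profile is at least
    its value at [M]; it must cover small [z], since it is applied to [u / (2 * s)] with [s]
    arbitrarily large. *)
Lemma error_tail_bounds (R : realType) (f : R -> R) (c : tail_case) (alpha : R) :
  error_assumption f c alpha ->
  exists M c1 c2 : R, [/\ expR 1 <= M, 0 < c1, 0 < c2,
    forall u : R, M <= u -> c1 * tail_profile c alpha u <= u * f u &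
    forall z : R, 0 < z -> z * f z <= c2 * tail_profile c alpha z].
Proof.
case=> f_pos f_mono [C C0 fC] [a0 [Cf Cf0 [cvf _]]].
have [M0 [_ HM0]] : \forall u \near +oo,
    2^-1 < f u / (Cf * tail_shape c alpha u) < 2.
  have := cvf; move/cvgrPdist_lt => /(_ 2^-1 ltac:(by rewrite invr_gt0)).
  apply: filterS => u; rewrite ltr_distlC => /andP[h1 h2].
  apply/andP; split; lra.
set M : R := Num.max (M0 + 1) (expR 1).
have Me : expR 1 <= M by rewrite le_max lexx orbT.
have e1 : 1 < expR 1 :> R by rewrite pexpR_gt1.
have key (u : R) : M <= u -> Cf / 2 * tail_profile c alpha u <= u * f u /\
    u * f u <= 2 * Cf * tail_profile c alpha u.
  move=> Mu; have u1 : 1 < u by apply: lt_le_trans Mu; exact: lt_le_trans e1 Me.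
  have M0u : M0 < u.
    by apply: lt_le_trans Mu; rewrite lt_max; apply/orP; left; lra.
  rewrite tail_shapeE; last exact: le_trans Mu.
  have := HM0 _ M0u; set T := tail_shape _ _ _.
  have T0 : 0 < T by exact: tail_shape_gt0.
  have CT0 : 0 < Cf * T by exact: mulr_gt0.
  rewrite ltr_pdivlMr// ltr_pdivrMr// => /andP[h1 h2].
  rewrite ![_ * (u * T)]mulrCA !ler_pM2l//; last 2 first.
  - by lra.
  - by lra.
  by split; lra.
have M0' : 0 < M by apply: lt_le_trans Me; lra.
have G0 : 0 < tail_profile c alpha M by exact: tail_profile_gt0.
exists M, (Cf / 2), (2 * Cf + C * M / tail_profile c alpha M).
have p1 : 0 < 2 * Cf by lra.
have p2 : 0 < C * M / tail_profile c alpha M by rewrite !mulr_gt0 ?invr_gt0.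
split => //; try by [lra|move=> u /key[]].
move=> z z0; have Gz := tail_profile_gt0 c alpha z0.
have [Mz|zM] := leP M z.
  apply: le_trans (key _ Mz).2 _.
  by rewrite ler_pM2r//; lra.
apply: (@le_trans _ _ (C * M / tail_profile c alpha M * tail_profile c alpha z)).
  apply: (@le_trans _ _ (C * M)).
    rewrite mulrC; apply: ler_pM => //; try lra.
    by have [] := f_pos z; lra.
  rewrite -mulrA ler_peMr ?mulr_ge0//; try lra.
  rewrite mulrC ler_pdivlMr// mul1r.
  by apply: tail_profile_anti => //; lra.
by rewrite ler_pM2r//; lra.
Qed.

Lemma outlier_ratio_bound (R : realType) (f : R -> R) (c : tail_case) (alpha : R) :
  error_assumption f c alpha ->
  exists (K u0 : R) (m : nat), [/\ 0 < K, 0 < u0 &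
   forall u mu s : R, u0 <= u -> 0 < s ->
    f ((u - mu) / s) / (s * f u) <=
    K * Num.max 1 s `^ tail_growth c alpha * Num.max 1 s^-1 * (1 + `|mu|) ^+ m].
Proof.
move=> A1; have [M [c1 [c2 [Me c10 c20 lo hi]]]] := error_tail_bounds A1.
case: A1 => f_pos f_mono [C C0 fC] [a0 _].
have [K1 K10 scale] := tail_profile_scale c a0.
have [m poly] := tail_profile_poly c a0.
have e1 : 1 < expR 1 :> R by rewrite pexpR_gt1.
have M0 : 0 < M by apply: lt_le_trans Me; lra.
(* [Ka] serves [|mu| <= u / 2] and [Kb] the opposite case; the remaining factors are at least 1, so
   the sum serves both. *)
pose Ka := 2 * c2 * K1 / c1; pose Kb := C * 2 ^+ m.+1 / c1.
have Ka0 : 0 < Ka by rewrite /Ka !mulr_gt0 ?invr_gt0.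
have Kb0 : 0 < Kb by rewrite /Kb !mulr_gt0 ?exprn_gt0 ?invr_gt0.
exists (Ka + Kb), M, m.+1; split => //; first by lra.
move=> u mu s Mu s0.
have u0 : 0 < u by lra.
have fu0 : 0 < f u by case: (f_pos u).
set S := Num.max 1 s `^ _; set V := Num.max 1 s^-1; set W := (1 + _) ^+ _.
have S1 : 1 <= S.
  rewrite -(powRr0 (Num.max 1 s)) ler_powR ?le_max ?lexx//.
  by rewrite /tail_growth; case: (c); lra.
have V1 : 1 <= V by rewrite le_max lexx.
have VS : s^-1 <= V by rewrite le_max lexx orbT.
have W1 : 1 <= W by rewrite exprn_ege1// lerDl.
have G0 := tail_profile_gt0 c alpha u0.
rewrite ler_pdivrMr ?mulr_gt0//.
have [mu_le|mu_gt] := leP `|mu| (u / 2).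
  have z0 : 0 < u / (2 * s) by rewrite divr_gt0// mulr_gt0.
  (* Here [|u - mu| >= u / 2], and [f] is antitone in the absolute value. *)
  have fle : f ((u - mu) / s) <= f (u / (2 * s)).
    have [_ ->] := f_pos ((u - mu) / s); rewrite -[in leRHS](gtr0_norm z0).
    apply: f_mono; rewrite (gtr0_norm z0) normrM normfV (gtr0_norm s0).
    rewrite invfM mulrA ler_pM2r ?invr_gt0//.
    have := ler_norm mu; have := ler_norm (u - mu); lra.
  apply: (le_trans fle).
  have : u / (2 * s) * f (u / (2 * s)) <= c2 * (K1 * (u * f u / c1) * S).
    apply: le_trans (hi _ z0) _; rewrite ler_pM2l//.
    apply: le_trans (scale _ _ u0 s0) _.
    rewrite ler_wpM2r ?powR_ge0// ler_pM2l// ler_pdivlMr// mulrC.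
    exact: lo.
  rewrite -ler_pdivlMl// => /le_trans; apply.
  have -> : (u / (2 * s))^-1 * (c2 * (K1 * (u * f u / c1) * S)) =
    Ka * S * (s * f u) by rewrite /Ka; field; rewrite !gt_eqF//; lra.
  rewrite ler_pM2r ?mulr_gt0//.
  apply: (@le_trans _ _ ((Ka + Kb) * S)); first by rewrite ler_wpM2r//; lra.
  rewrite -mulrA ler_peMr//; first by rewrite mulr_ge0//; lra.
  by rewrite -[leLHS]mulr1 ler_pM.
(* Now [u < 2 * |mu|]: the numerator is bounded by [C], and [1 / f u <= u ^+ m.+1 / c1] is a
   polynomial in [|mu|]. The extra power of [u] comes from bounding [u * f u] instead of [f u]. *)
have uf : c1 <= u * f u * u ^+ m.
  have /ler_wpM2r := lo _ Mu => /(_ (u ^+ m) (exprn_ge0 _ (ltW u0))).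
  apply: le_trans; rewrite -mulrA ler_peMr//; first by lra.
  by apply: poly; exact: le_trans Mu.
have uW : u ^+ m.+1 <= 2 ^+ m.+1 * W.
  by rewrite -exprMn lerXn2r ?nnegrE//; lra.
apply: le_trans (fC _) _.
apply: (@le_trans _ _ (Kb * s^-1 * W * (s * f u))).
  rewrite /Kb.
  have -> : C * 2 ^+ m.+1 / c1 * s^-1 * W * (s * f u) =
    C / c1 * ((2 ^+ m.+1 * W) * f u) by field; rewrite !gt_eqF.
  apply: (@le_trans _ _ (C / c1 * (u ^+ m.+1 * f u))).
    rewrite -mulrA ler_peMr//; first by lra.
    rewrite mulrC ler_pdivlMr// mul1r exprSr.
    by rewrite [_ * u]mulrC mulrAC.
  by rewrite ler_pM2l ?divr_gt0// ler_pM2r.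
rewrite ler_pM2r ?mulr_gt0// ler_wpM2r//; first by lra.
apply: ler_pM => //; try by rewrite ?invr_ge0; lra.
by rewrite -[leLHS]mulr1 ler_pM//; lra.
Qed.

(** * Pointwise limit of an outlier factor *)

Lemma powRVl (R : realType) (x r : R) : 0 <= x -> x^-1 `^ r = (x `^ r)^-1.
Proof. by move=> x0; rewrite -powR_inv1// -powRrM mulN1r powRN. Qed.

Lemma cvg_powR (R : realType) (T : Type) (F : set_system T) {FF : Filter F}
    (g : T -> R) (l r : R) : 0 < l ->
  g t @[t --> F] --> l -> (g t) `^ r @[t --> F] --> l `^ r.
Proof.
move=> l0 gl; apply: (@cvg_comp _ _ _ g (fun x : R => x `^ r) F (nbhs l)) => //.
suff : {for l, continuous (fun x : R => x `^ r)} by [].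
apply: differentiable_continuous; apply/derivable1_diffP.
by apply: derivable_powR; rewrite in_itv/= l0.
Qed.

Lemma cvg_lny (R : realType) : ln u @[u --> (+oo : set_system R)] --> +oo.
Proof.
apply/cvgryPge => A; near=> u.
rewrite -[A]expRK ler_ln ?posrE ?expR_gt0//; last first.
Unshelve. all: by end_near. Qed.

(** For a power the ratio depends on [(u - mu) / u / s], which tends to [s^-1], and the limit is
    [s ^ (alpha + 1) / s]. In the log case the [s] coming from the reciprocal of [(u - mu) / s]
    cancels the one in the denominator, and the quotient of the logarithms tends to 1. *)
Lemma tail_shape_ratio_cvg (R : realType) (c : tail_case) (alpha mu s : R) :
  0 < s ->
  tail_shape c alpha ((u - mu) / s) / (s * tail_shape c alpha u) @[u --> +oo] -->
  outlier_weight c alpha s.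
Proof.
move=> s0.
have s00 : s != 0 by rewrite gt_eqF.
have inv0 : u^-1 @[u --> +oo] --> (0 : R).
  apply/gtr0_cvgV0; last exact: cvg_id.
  by apply: nbhs_pinfty_gt; exact: num_real.
have r1 : (u - mu) / u @[u --> +oo] --> (1 : R).
  have : 1 - mu * u^-1 @[u --> +oo] --> (1 - mu * 0 : R).
    by apply: cvgB; [exact: cvg_cst|apply: cvgMr].
  rewrite mulr0 subr0; apply: cvg_trans; apply: near_eq_cvg.
  near=> u; have u0 : 0 < u by near: u; apply: nbhs_pinfty_gt; exact: num_real.
  by field; rewrite gt_eqF.
have r2 : (u - mu) / u / s @[u --> +oo] --> s^-1.
  by rewrite -[X in _ --> X]mul1r; apply: cvgM => //; exact: cvg_cst.
have invs : 0 < s^-1 by rewrite invr_gt0.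
rewrite /tail_shape; case: c.
  have : ((u - mu) / u / s) `^ (- (alpha + 1)) * s^-1 @[u --> +oo] -->
      s^-1 `^ (- (alpha + 1)) * s^-1.
    by apply: cvgM; [exact: cvg_powR|exact: cvg_cst].
  have -> : s^-1 `^ (- (alpha + 1)) * s^-1 = outlier_weight RegularlyVarying alpha s.
    rewrite /= -powR_inv1 ?ltW// -powRrM -powRD; last by rewrite s00 implybT.
    by congr (_ `^ _); ring.
  apply: cvg_trans; apply: near_eq_cvg; near=> u.
  have u0 : 0 < u by near: u; apply: nbhs_pinfty_gt; exact: num_real.
  have um : mu < u by near: u; apply: nbhs_pinfty_gt; exact: num_real.
  have um0 : 0 < u - mu by lra.
  rewrite !gtr0_norm ?divr_gt0//.
  have -> : (u - mu) / u / s = ((u - mu) / s) / u by field; rewrite s00 gt_eqF.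
  have su0 : 0 < (u - mu) / s by rewrite divr_gt0.
  rewrite [in LHS]powRM ?invr_ge0 ?(ltW u0) ?(ltW su0)//.
  by rewrite powRVl ?(ltW u0)// invfM mulrA mulrAC.
(* The numerator is [ln u] plus the logarithm of [(u - mu) / u / s], which converges and so is
   negligible against [ln u]. *)
have rl : ln ((u - mu) / s) / ln u @[u --> +oo] --> (1 : R).
  have lninv : (ln u)^-1 @[u --> +oo] --> (0 : R).
    apply/gtr0_cvgV0; last exact: cvg_lny.
    near=> u; apply: ln_gt0; near: u; apply: nbhs_pinfty_gt; exact: num_real.
  have lnr : ln ((u - mu) / u / s) @[u --> +oo] --> ln s^-1.
    apply: (@cvg_comp _ _ _ (fun u => (u - mu) / u / s) (@ln R) _ (nbhs s^-1)) => //.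
    exact: continuous_ln.
  have : 1 + ln ((u - mu) / u / s) * (ln u)^-1 @[u --> +oo] --> (1 + ln s^-1 * 0 : R).
    by apply: cvgD; [exact: cvg_cst|exact: cvgM].
  rewrite mulr0 addr0; apply: cvg_trans; apply: near_eq_cvg; near=> u.
  have u1 : 1 < u by near: u; apply: nbhs_pinfty_gt; exact: num_real.
  have um : mu < u by near: u; apply: nbhs_pinfty_gt; exact: num_real.
  have um0 : 0 < u - mu by lra.
  have u0 : 0 < u by lra.
  have l0 : 0 < ln u by exact: ln_gt0.
  rewrite /= -[X in X + _ = _](@divff _ (ln u)) ?gt_eqF// -mulrDl -lnM ?posrE ?divr_gt0//.
  by congr (ln _ / _); field; rewrite s00 gt_eqF.
have rlp : (ln ((u - mu) / s) / ln u) `^ (- (alpha + 1)) @[u --> +oo] -->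
    1 `^ (- (alpha + 1)) by exact: cvg_powR.
rewrite powR1 in rlp.
have : ((u - mu) / u)^-1 * (ln ((u - mu) / s) / ln u) `^ (- (alpha + 1)) @[u --> +oo] -->
    (1^-1 * 1 : R).
  by apply: cvgM => //; apply: cvgV => //; exact: oner_neq0.
rewrite invr1 mul1r; apply: cvg_trans; apply: near_eq_cvg; near=> u.
have u1 : 1 < u by near: u; apply: nbhs_pinfty_gt; exact: num_real.
have um : mu + s < u by near: u; apply: nbhs_pinfty_gt; exact: num_real.
have um0 : 0 < u - mu by lra.
have u0 : 0 < u by lra.
have l0 : 0 < ln u by exact: ln_gt0.
have su0 : 0 < (u - mu) / s by rewrite divr_gt0.
have l1 : 0 < ln ((u - mu) / s) by rewrite ln_gt0// ltr_pdivlMr// mul1r; lra.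
rewrite !gtr0_norm//.
rewrite [in LHS]powRM ?invr_ge0 ?(ltW l0) ?(ltW l1)//.
rewrite powRVl ?(ltW l0)//.
set A := _ `^ (- (alpha + 1)); set B := _ `^ (- (alpha + 1)).
have B0 : B != 0 by rewrite gt_eqF// powR_gt0.
by field; rewrite B0 s00 !gt_eqF.
Unshelve. all: by end_near. Qed.

(** At both [(u - mu) / s] and [u], [f] is replaced by its asymptotic form; [Cf] cancels and the
    ratio of the tail shapes remains. *)
Lemma outlier_ratio_cvg (R : realType) (f : R -> R) (c : tail_case)
    (alpha mu s : R) : error_assumption f c alpha -> 0 < s ->
  f ((u - mu) / s) / (s * f u) @[u --> +oo] --> outlier_weight c alpha s.
Proof.
case=> f_pos f_mono _ [a0 [Cf Cf0 [cvf _]]] s0.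
have sh : (u - mu) / s @[u --> +oo] --> +oo.
  apply: gt0_cvgMly; rewrite ?invr_gt0//; exact: cvg_addrr.
have cvfs : f ((u - mu) / s) / (Cf * tail_shape c alpha ((u - mu) / s)) @[u --> +oo] --> (1 : R).
  exact: (@cvg_comp _ _ _ (fun u => (u - mu) / s)
    (fun y => f y / (Cf * tail_shape c alpha y)) _ _ _ sh cvf).
have : (f ((u - mu) / s) / (Cf * tail_shape c alpha ((u - mu) / s))) *
    (f u / (Cf * tail_shape c alpha u))^-1 *
    (tail_shape c alpha ((u - mu) / s) / (s * tail_shape c alpha u)) @[u --> +oo] -->
    1 * 1^-1 * outlier_weight c alpha s.
  apply: cvgM; last exact: tail_shape_ratio_cvg.
  apply: cvgM; first exact: cvfs.
  by apply: cvgV; [exact: oner_neq0|exact: cvf].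
rewrite invr1 !mul1r; apply: cvg_trans; apply: near_eq_cvg; near=> u.
have u1 : 1 < u by near: u; apply: nbhs_pinfty_gt; exact: num_real.
have um : mu + s < u by near: u; apply: nbhs_pinfty_gt; exact: num_real.
have su1 : 1 < (u - mu) / s by rewrite ltr_pdivlMr// mul1r; lra.
have [fu0 _] := f_pos u.
have T0 := tail_shape_gt0 c alpha u1.
have T1 := tail_shape_gt0 c alpha su1.
by field; rewrite !gt_eqF.
Unshelve. all: by end_near. Qed.

(** * Measure theory on the parameter space *)

Lemma rat_approx (R : realType) (x e : R) : 0 < e -> exists q : rat, `|x - ratr q| < e.
Proof.
move=> e0; have [|y [xy [q _ qy]]] := @dense_rat R (ball x e) _ (ball_open x e).
  by exists x; exact: ballxx.
by exists q; rewrite qy.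
Qed.

(** Links the topology that defines convergence in distribution with the sigma-algebra generated by
    the coordinates, so that continuous test functions can be integrated. *)
Lemma measurable_param_open (R : realType) (p : nat) (U : set ('cV[R]_p * R)) :
  open U -> measurable (U : set ('cV[R]_p * measurableTypeR R)).
Proof.
move=> oU.
pose box (i : {ffun 'I_p -> rat} * rat * nat) : set ('cV[R]_p * measurableTypeR R) :=
  [set z : 'cV[R]_p * R | (forall j, `|z.1 j 0 - ratr (i.1.1 j)| < i.2.+1%:R^-1) /\
    `|z.2 - ratr i.1.2| < i.2.+1%:R^-1].
have mbox i : measurable (box i).
  rewrite [X in measurable X](_ : _ =
    (\bigcap_(j in [set: 'I_p]) (cV_coord j @^-1` ball (ratr (i.1.1 j) : R) i.2.+1%:R^-1))
     `*` (ball (ratr i.1.2 : R) i.2.+1%:R^-1)).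
    apply: measurableX; last exact: measurable_ball.
    apply: fin_bigcap_measurable => [|j _]; first exact: finite_finset.
    rewrite -[X in measurable X]setTI; apply: measurable_cV_coord => //.
    exact: measurable_ball.
  apply/seteqP; split => -[v s] /= [H1 H2]; split.
  - by move=> j _; rewrite /= /ball /= distrC; exact: H1.
  - by rewrite /ball /= distrC.
  - by move=> j; rewrite distrC; exact: (H1 j).
  - by rewrite distrC.
(* rational boxes form a countable base *)
have -> : U = \bigcup_i [set z | box i z /\ box i `<=` U].
  apply/seteqP; split=> [[v s] Uz|z [i _ [iz]]]; last exact.
  have /nbhs_ballP[e /= e0 eU] : nbhs (v, s) U by exact: open_nbhs_nbhs.
  (* Half of [e], because a point of the box is compared with [(v, s)] through the rational
     centre. *)
  have [k] : exists k : nat, k.+1%:R^-1 < e / 2.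
    have := near_infty_natSinv_lt (PosNum (divr_gt0 e0 (@ltr0n R 2))).
    by case=> k _ /(_ k (leqnn k)) /=; exists k.
  set r := k.+1%:R^-1 => rk.
  have r0 : 0 < r by rewrite invr_gt0.
  have [q qE] := choice (fun j : 'I_p => rat_approx (v j 0) r0).
  have [t tE] := rat_approx s r0.
  exists ([ffun j => q j], t, k) => //.
  split; first by split => //= j; rewrite ffunE.
  move=> -[v' s'] [/= H1 H2]; apply: eU; split.
    split => // i j; rewrite ord1 /ball /=.
    have := H1 i; rewrite ffunE => {}H1.
    rewrite -(subrKA (ratr (q i))) (le_lt_trans (ler_normD _ _))//.
    rewrite [X in _ + X]distrC.
    by apply: lt_trans (ltrD (qE i) H1) _; rewrite -/r; lra.
  rewrite /ball /= -(subrKA (ratr t)) (le_lt_trans (ler_normD _ _))//.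
  rewrite [X in _ + X]distrC.
  by apply: lt_trans (ltrD tE H2) _; rewrite -/r; lra.
apply: countable_bigcupT_measurable; first exact: countableP.
move=> i; have [iU|iU] := pselect (box i `<=` U).
  by rewrite (_ : [set z | _] = box i)//; apply/seteqP; split => // z [].
by rewrite (_ : [set z | _] = set0)//; apply/seteqP; split => // z [].
Qed.

Lemma open_param_space (R : realType) (p : nat) : open (@param_space R p).
Proof.
rewrite (_ : param_space p = snd @^-1` [set x : R | 0 < x])//.
by apply: open_comp; [move=> z _; exact: cvg_snd|exact: open_gt].
Qed.

Lemma measurable_param_space (R : realType) (p : nat) :
  measurable (param_space p : set ('cV[R]_p * measurableTypeR R)).
Proof. by apply: measurable_param_open; exact: open_param_space. Qed.

(** Since [param_space] is open, the preimage of an open ray within it is open in the whole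
    space. *)
Lemma within_continuous_measurable_param (R : realType) (p : nat)
    (h : 'cV[R]_p * R -> R) : {within param_space p, continuous h} ->
  measurable_fun (param_space p : set ('cV[R]_p * measurableTypeR R)) h.
Proof.
move=> ch; apply: (measurability _ (RGenOInfty.measurableE R)) => _ [_ [a ->] <-].
apply: measurable_param_open; rewrite openE => z [Dz az].
rewrite /interior.
have Dn : nbhs z (param_space p) by apply: open_nbhs_nbhs; split => //; exact: open_param_space.
have /= hz := (subspace_continuousP _ _).1 ch z Dz.
have : nbhs (h z) `]a, +oo[%classic by apply: open_nbhs_nbhs; split => //; exact: interval_open.
move=> /hz; rewrite /= nbhs_simpl/= => H.
by apply: filterS2 Dn H => y Dy Hy; split => //; exact: Hy.
Qed.

(** * Integration against a measure with a density *)

Section density_measure.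
Context d (T : measurableType d) (R : realType) (mu : {measure set T -> \bar R}).
Local Open Scope ereal_scope.
Variable q : T -> R.

(** The proofs [mq] and [q0] are arguments so that the measure structure declared below can be
    inferred from the term. *)
Definition density_measure (mq : measurable_fun [set: T] q)
    (q0 : forall x, (0 <= q x)%R) : set T -> \bar R :=
  fun A => \int[mu]_(x in A) (q x)%:E.

Hypothesis mq : measurable_fun [set: T] q.
Hypothesis q0 : forall x, (0 <= q x)%R.

Local Notation nu := (density_measure mq q0).

Let q0E x : 0 <= (q x)%:E. Proof. by rewrite lee_fin. Qed.

Let mqE : measurable_fun [set: T] (EFin \o q).
Proof. exact/measurable_EFinP. Qed.

Let nu0 : nu set0 = 0. Proof. exact: integral_set0. Qed.

Let nu_ge0 A : 0 <= nu A. Proof. exact: integral_ge0. Qed.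

Let nu_sigma_additive : semi_sigma_additive nu.
Proof. exact: semi_sigma_additive_nng_induced mqE q0E. Qed.

HB.instance Definition _ := isMeasure.Build _ _ _ nu nu0 nu_ge0 nu_sigma_additive.

Import HBNNSimple.

(** By linearity over the finite range this reduces to indicators of level sets, where it is the
    definition of the measure. *)
Let integral_nnsfun (h : {nnsfun T >-> R}) :
  \int[nu]_x (h x)%:E = \int[mu]_x ((h x)%:E * (q x)%:E).
Proof.
under [LHS]eq_integral do rewrite fimfunE -fsumEFin//.
rewrite [LHS]ge0_integral_fsum//; last 2 first.
  - by move=> r; exact/measurable_EFinP/measurableT_comp.
  - by move=> r x _; rewrite EFinM nnfun_muleindic_ge0.
under [RHS]eq_integral.
  move=> x _; rewrite fimfunE -fsumEFin// ge0_mule_fsuml; last first.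
    by move=> r; rewrite EFinM nnfun_muleindic_ge0.
  over.
rewrite [RHS]ge0_integral_fsum//; last 2 first.
  - move=> r; apply: emeasurable_funM => //.
    by apply/measurable_EFinP; exact: measurableT_comp.
  - by move=> r x _; rewrite mule_ge0// EFinM nnfun_muleindic_ge0.
apply: eq_fsbigr => r; rewrite inE => -[t _ rE].
have r0 : 0 <= r%:E by rewrite -rE lee_fin.
under [LHS]eq_integral do rewrite EFinM.
under [RHS]eq_integral do rewrite EFinM -muleA.
rewrite integralZl_indic_nnsfun//= integral_indic//= setIT.
rewrite ge0_integralZl//; last 2 first.
- by apply: emeasurable_funM => //; exact/measurable_EFinP.
- by move=> x _; rewrite mule_ge0// lee_fin.
congr (_ * _); rewrite /density_measure.
rewrite integral_mkcond; apply: eq_integral => x _.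
by rewrite epatch_indic muleC.
Qed.

(** Monotone convergence on both sides, along simple functions increasing to [h]. *)
Lemma ge0_integral_density (h : T -> \bar R) :
  measurable_fun [set: T] h -> (forall x, 0 <= h x) ->
  \int[nu]_x h x = \int[mu]_x (h x * (q x)%:E).
Proof.
move=> mh h0; pose h_ := nnsfun_approx measurableT mh.
have cvh x : (h_ n x)%:E @[n --> \oo] --> h x.
  by apply: cvg_nnsfun_approx => // y _; exact: h0.
have ndh x m n : (m <= n)%N -> ((h_ m x)%:E <= (h_ n x)%:E).
  by move=> mn; rewrite lee_fin; exact/lefP/nd_nnsfun_approx.
transitivity (lim (\int[nu]_x (h_ n x)%:E @[n --> \oo])).
  rewrite -monotone_convergence//=.
  - by apply: eq_integral => x _; apply/esym/cvg_lim.
  - by move=> n; exact/measurable_EFinP/measurable_funTS.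
  - by move=> n x _; rewrite lee_fin.
  - by move=> x _ m n mn; exact: ndh.
under eq_fun do rewrite integral_nnsfun.
rewrite -monotone_convergence//=.
- by apply: eq_integral => x _; apply/cvg_lim => //; exact: cvgeZr.
- move=> n; apply: emeasurable_funM => //.
  exact/measurable_EFinP/measurable_funTS.
- by move=> n x _; rewrite mule_ge0// lee_fin.
- by move=> x _ m n mn; rewrite lee_wpmul2r// ndh.
Qed.

(** Multiplication by a nonnegative [q] commutes with taking positive and negative parts. *)
Lemma integral_density (h : T -> \bar R) : measurable_fun [set: T] h ->
  \int[nu]_x h x = \int[mu]_x (h x * (q x)%:E).
Proof.
move=> mh; rewrite [LHS]integralE [RHS]integralE.
have posM (u : \bar R) (r : R) : (0 <= r)%R ->
    maxe (u * r%:E) 0 = maxe u 0 * r%:E.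
  by move=> r0; rewrite ![_ * r%:E]muleC maxe_pMr ?lee_fin// mule0.
rewrite !ge0_integral_density//; last 2 first.
- exact: measurable_funeneg.
- exact: measurable_funepos.
congr (_ - _); apply: eq_integral => x _.
- by rewrite !funeposE posM.
- by rewrite !funenegE -mulNe posM.
Qed.

End density_measure.

(** * Dominated convergence along a real parameter *)

Section dominated_pinfty.
Context d (T : measurableType d) (R : realType) (mu : {measure set T -> \bar R}).
Variables (D : set T) (F : R -> T -> R) (L g : T -> R) (w0 : R).
Hypothesis mD : measurable D.
Hypothesis mF : forall w, measurable_fun D (F w).
Hypothesis FL : forall z, D z -> F w z @[w --> +oo] --> L z.
Hypothesis ig : mu.-integrable D (EFin \o g).
Hypothesis Fg : forall w z, w0 <= w -> D z -> `|F w z| <= g z.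

Lemma integrable_dominated (w : R) : w0 <= w -> mu.-integrable D (EFin \o F w).
Proof.
move=> ww; apply: le_integrable ig => //; first exact/measurable_EFinP.
move=> z Dz /=; rewrite lee_fin; apply: le_trans (Fg ww Dz) _.
exact: ler_norm.
Qed.

(** Taking the maximum with [w0] makes the domination hold at every index and changes only finitely
    many terms. The limit [L] is measurable as a pointwise limit. *)
Let seq_cvg (u : R^nat) : u n @[n --> \oo] --> +oo ->
  mu.-integrable D (EFin \o L) /\
  (\int[mu]_(z in D) (F (Num.max (u n) w0) z)%:E)%E @[n --> \oo] -->
    (\int[mu]_(z in D) (L z)%:E)%E.
Proof.
move=> uoo; pose v n := Num.max (u n) w0.
have voo : v n @[n --> \oo] --> +oo.
  apply/cvgryPge => A; near=> n; rewrite le_max; apply/orP; left.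
  by near: n; move/cvgryPge : uoo; exact.
have FvL z : D z -> (F (v n) z)%:E @[n --> \oo] --> (L z)%:E.
  move=> Dz; apply: cvg_EFin; first exact: nearW.
  exact: (@cvg_comp _ _ _ v (F ^~ z) _ _ _ voo (FL Dz)).
have mFv n : measurable_fun D (EFin \o F (v n)) by exact/measurable_EFinP.
have mL : measurable_fun D (EFin \o L) by exact: emeasurable_fun_cvg mFv FvL.
have Fvg n z : D z -> (`|(EFin \o F (v n)) z| <= (EFin \o g) z)%E.
  by move=> Dz; rewrite /= lee_fin; apply: Fg => //; rewrite le_max lexx orbT.
by have [] := @dominated_convergence _ _ _ mu D mD (fun n => EFin \o F (v n))
  (EFin \o L) (EFin \o g) mFv mL (aeW _ FvL) ig (aeW _ (fun z n => @Fvg n z)).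
Unshelve. all: by end_near. Qed.

Lemma integrable_dominated_limit : mu.-integrable D (EFin \o L).
Proof. by have [] := seq_cvg (@cvgr_idn R). Qed.

Lemma dominated_cvg_pinfty :
  fine (\int[mu]_(z in D) (F w z)%:E)%E @[w --> +oo] -->
  fine (\int[mu]_(z in D) (L z)%:E)%E.
Proof.
apply/cvg_pinftyP => u uoo.
have [iL cvu] := seq_cvg uoo.
rewrite -(fineK (integrable_fin_num mD iL)) in cvu.
move/fine_cvg in cvu.
apply: cvg_trans cvu; apply: near_eq_cvg; near=> n.
rewrite /= max_l//; near: n.
by move/cvgryPge : uoo; exact.
Unshelve. all: by end_near. Qed.

End dominated_pinfty.

(** * The likelihood ratio *)

Definition coord_norm (R : realType) (p : nat) (v : 'cV[R]_p) : R :=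
  1 + \sum_j `|v j 0|.

Lemma coord_norm_ge1 (R : realType) (p : nat) (v : 'cV[R]_p) : 1 <= coord_norm v.
Proof. by rewrite lerDl sumr_ge0. Qed.

(** Both norms being nonnegative, [1 + A * B <= (1 + A) * (1 + B)]. This turns the factors
    [1 + |mu|] of all observations into powers of one norm of [beta]. *)
Lemma dot_le_coord_norm (R : realType) (p : nat) (u v : 'cV[R]_p) :
  1 + `|(u^T *m v) 0 0| <= coord_norm u * coord_norm v.
Proof.
have H : `|(u^T *m v) 0 0| <= (\sum_j `|u j 0|) * (\sum_j `|v j 0|).
  rewrite mxE (le_trans (ler_norm_sum _ _ _))// mulr_suml ler_sum// => i _.
  rewrite normrM mxE ler_wpM2l// (bigD1 i)//= lerDl.
  by apply: sumr_ge0.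
have S0 (w : 'cV[R]_p) : 0 <= \sum_j `|w j 0| by exact: sumr_ge0.
have := S0 u; have := S0 v; rewrite /coord_norm; nra.
Qed.

Section likelihood_ratio.
Variables (R : realType) (n p : nat) (x : 'I_n -> 'cV[R]_p) (f : R -> R)
  (c : tail_case) (alpha : R) (sgn : 'I_n -> bool) (a b : 'I_n -> R).
Hypothesis A1 : error_assumption f c alpha.
Hypothesis b_values : forall i, b i = 0 \/ 1 <= b i.
Hypothesis a_gt0 : forall i, 0 < a i.

Local Notation out := (outliers b).
Local Notation y := (response sgn a b).

Definition likelihood_ratio (w : R) (z : 'cV[R]_p * R) : R :=
  likelihood x f (y w) [set: 'I_n]%SET z / \prod_(i in out) f (y w i).

Let f_gt0 v : 0 < f v. Proof. by case: A1 => /(_ v)[]. Qed.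

Let f_even v : f (- v) = f v.
Proof. by case: A1 => H _ _ _; rewrite (H (- v)).2 normrN -(H v).2. Qed.

Let f_sign (s : bool) v : f ((-1) ^+ s * v) = f v.
Proof. by case: s; rewrite ?expr1 ?mulN1r ?f_even ?expr0 ?mul1r. Qed.

(** Evenness of [f] moves the sign of the response onto the linear predictor, so that only responses
    tending to [+oo] have to be treated. *)
Let factor_ratio w (z : 'cV[R]_p * R) i : z.2 != 0 ->
  z.2^-1 * f ((y w i - ((x i)^T *m z.1) 0 0) / z.2) / f (y w i) =
  f ((a i + b i * w - (-1) ^+ sgn i * ((x i)^T *m z.1) 0 0) / z.2) /
    (z.2 * f (a i + b i * w)).
Proof.
move=> s0; set mu := (_ *m _) 0 0.
have -> : f ((y w i - mu) / z.2) =
    f ((a i + b i * w - (-1) ^+ sgn i * mu) / z.2).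
  rewrite -(f_sign (sgn i) ((y w i - mu) / z.2)) mulrA mulrBr.
  by rewrite /response mulrA -expr2 sqrr_sign mul1r.
rewrite /response f_sign.
by field; rewrite s0 gt_eqF.
Qed.

(** All dependence on [w] is isolated in the outlier factors: outside [out] one has [b i = 0]. *)
Lemma likelihood_ratioE w (z : 'cV[R]_p * R) : z.2 != 0 ->
  likelihood_ratio w z = likelihood x f (fixed_response sgn a) (~: out) z *
  \prod_(i in out) (f ((a i + b i * w - (-1) ^+ sgn i * ((x i)^T *m z.1) 0 0) / z.2) /
    (z.2 * f (a i + b i * w))).
Proof.
move=> s0; rewrite /likelihood_ratio /likelihood (bigID (mem out))/=.
under eq_bigl do rewrite finset.inE andTb.
rewrite [X in _ * X / _ = _](_ : _ = likelihood x f (fixed_response sgn a) (~: out) z).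
  rewrite mulrAC mulrC -prodf_div; congr (_ * _).
  by apply: eq_bigr => i _; exact: factor_ratio.
rewrite /likelihood; apply: eq_big => [i|i]; first by rewrite !finset.inE.
rewrite /= => iout; rewrite /response /fixed_response.
case: (b_values i) => [->|bi]; first by rewrite mul0r addr0.
by move: iout; rewrite !finset.inE bi.
Qed.

Lemma cvg_likelihood_ratio (z : 'cV[R]_p * R) : 0 < z.2 ->
  likelihood_ratio w z @[w --> +oo] -->
  outlier_weight c alpha z.2 ^+ #|out| *
    likelihood x f (fixed_response sgn a) (~: out) z.
Proof.
move=> s0; rewrite mulrC.
under eq_fun do rewrite likelihood_ratioE ?gt_eqF//.
apply: cvgM; first exact: cvg_cst.
rewrite -prodr_const; apply: cvg_big => [|i iout].
  exact: mul_continuous.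
have b1 : 1 <= b i by move: iout; rewrite finset.inE.
have yoo : a i + b i * w @[w --> +oo] --> +oo.
  apply/cvgryPge => A; near=> w.
  have w0 : 0 <= w by near: w; apply: nbhs_pinfty_ge; exact: num_real.
  have Aw : A <= w by near: w; apply: nbhs_pinfty_ge; exact: num_real.
  have := a_gt0 i; nra.
exact: (@cvg_comp _ _ _ _ _ _ _ _ yoo (outlier_ratio_cvg _ A1 s0)).
Unshelve. all: by end_near. Qed.

Hypothesis A3 : outlier_proportion c alpha out.

(** The common form in which both cases of the bound on the number of outliers enter the
    domination. *)
Let growth_le : tail_growth c alpha * #|out|%:R <= #|~: out|%:R.
Proof.
move: A3; rewrite /outlier_proportion /tail_growth; case: c => [/ltW//|].
by rewrite mul1r ler_nat.
Qed.

Lemma likelihood_ratio_bound : exists (K w0 : R) (N : nat), forall w z,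
  w0 <= w -> 0 < z.2 ->
  0 <= likelihood_ratio w z <= K * (Num.max 1 z.2^-1 ^+ n * coord_norm z.1 ^+ N).
Proof.
have [K [u0 [m [K0 u00 bound]]]] := outlier_ratio_bound A1.
have [C C0 fC] : exists2 C : R, 0 < C & forall v, f v <= C by case: A1.
pose X : R := \sum_i coord_norm (x i).
pose k := #|out|; pose k' := #|~: out|.
have kk : (k + k')%N = n by rewrite /k /k' cardsC card_ord.
exists (C ^+ k' * (K * X ^+ m) ^+ k), u0, (m * k)%N => w z ww s0.
rewrite likelihood_ratioE ?gt_eqF//.
set s := z.2; set V := Num.max 1 s^-1; set B := coord_norm z.1.
set S := Num.max 1 s `^ tail_growth c alpha.
have V1 : 1 <= V by rewrite le_max lexx.
have V0 : 0 <= V by lra.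
have S0 : 0 <= S by exact: powR_ge0.
have sV0 : 0 <= s^-1 by rewrite invr_ge0 ltW.
apply/andP; split.
  rewrite mulr_ge0//; apply: prodr_ge0 => i _.
    by rewrite mulr_ge0// ltW.
  by rewrite divr_ge0 ?mulr_ge0// ltW.
have H1 : likelihood x f (fixed_response sgn a) (~: out) z <= (C / s) ^+ k'.
  rewrite /likelihood -prodr_const; apply: ler_prod => i _.
  by rewrite mulr_ge0 ?(ltW (f_gt0 _))//= mulrC ler_wpM2r.
have H2 : \prod_(i in out)
    (f ((a i + b i * w - (-1) ^+ sgn i * ((x i)^T *m z.1) 0 0) / z.2) /
      (z.2 * f (a i + b i * w))) <= (K * S * V * (X * B) ^+ m) ^+ k.
  rewrite -prodr_const; apply: ler_prod => i iout.
  rewrite divr_ge0 ?mulr_ge0 ?(ltW (f_gt0 _)) ?(ltW s0)//=.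
  have b1 : 1 <= b i by move: iout; rewrite finset.inE.
  have uw : u0 <= a i + b i * w.
    have := a_gt0 i; have : 0 < w by exact: lt_le_trans ww.
    by nra.
  apply: le_trans (bound _ _ _ uw s0) _.
  rewrite -/s -/V -/S ler_wpM2l ?mulr_ge0 ?(ltW K0)//.
  rewrite normrM normrX normrN1 expr1n mul1r lerXn2r ?nnegrE ?addr_ge0//.
    rewrite mulr_ge0 ?sumr_ge0 ?(le_trans ler01 (coord_norm_ge1 _))// => j _.
    exact: le_trans ler01 (coord_norm_ge1 _).
  apply: le_trans (dot_le_coord_norm _ _) _.
  rewrite ler_wpM2r ?(le_trans ler01 (coord_norm_ge1 _))//.
  rewrite /X (bigD1 i)//= lerDl sumr_ge0// => j _.
  exact: le_trans ler01 (coord_norm_ge1 _).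
(* For [s >= 1] the left side is a power of [s] with exponent at most 0, by [growth_le]; for
   [s < 1], [S = 1] and [s^-1 <= V]. *)
have H3 : s^-1 ^+ k' * S ^+ k <= V ^+ k'.
  have [s1|s1] := leP 1 s.
    rewrite /S (max_r s1) -powR_mulrn ?powR_ge0// -powRrM.
    apply: (@le_trans _ _ 1); last by rewrite exprn_ege1.
    rewrite exprVn mulrC ler_pdivrMr ?exprn_gt0// mul1r.
    rewrite -powR_mulrn ?(ltW s0)//.
    exact: ler_powR.
  rewrite /S (max_l (ltW s1)) powR1 expr1n mulr1.
  by rewrite lerXn2r ?nnegrE// /V le_max lexx orbT.
apply: le_trans (ler_pM _ _ H1 H2) _.
- by apply: prodr_ge0 => i _; rewrite mulr_ge0// ltW.
- by apply: prodr_ge0 => i _; rewrite divr_ge0 ?mulr_ge0// ltW.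
rewrite -[X in V ^+ X]kk exprD.
have -> : (C / s) ^+ k' * (K * S * V * (X * B) ^+ m) ^+ k =
  (C ^+ k' * (K * X ^+ m) ^+ k * (V ^+ k * B ^+ (m * k))) * (s^-1 ^+ k' * S ^+ k).
  by rewrite !exprMn exprM; ring.
have -> : C ^+ k' * (K * X ^+ m) ^+ k * (V ^+ k * V ^+ k' * B ^+ (m * k)) =
  (C ^+ k' * (K * X ^+ m) ^+ k * (V ^+ k * B ^+ (m * k))) * V ^+ k' by ring.
apply: ler_wpM2l => //.
have X0 : 0 <= X by apply: sumr_ge0 => i _; exact: le_trans ler01 (coord_norm_ge1 _).
have B0 : 0 <= B by exact: le_trans ler01 (coord_norm_ge1 _).
by rewrite !mulr_ge0 ?exprn_ge0 ?mulr_ge0 ?exprn_ge0 ?(ltW K0) ?(ltW C0).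
Qed.

End likelihood_ratio.

(** * Integrability under the prior *)

Section param_integral.
Variables (R : realType) (p : nat) (q : 'cV[R]_p * R -> R).
Local Notation T := ('cV[R]_p * measurableTypeR R)%type.
Local Notation D := (param_space p : set T).
Hypothesis mq : measurable_fun D q.
Hypothesis q0 : forall z, D z -> 0 <= q z.

Let mq' : measurable_fun [set: T] (q \_ D).
Proof. exact: (measurable_restrictT q (@measurable_param_space R p)).1 mq. Qed.

Let q'0 z : 0 <= (q \_ D) z.
Proof. by rewrite patchE; case: ifPn => // /set_mem; exact: q0. Qed.

(** Extended by 0 outside [param_space], [q] is measurable and nonnegative everywhere, which makes
    [param_law q] a measure. *)
Lemma param_law_density : param_law q = density_measure (@lebesgue_param R p) mq' q'0.
Proof.
apply/funext => B; rewrite /param_law /density_measure integral_mkcondr.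
by apply: eq_integral => z _; rewrite restrict_EFin.
Qed.

Lemma integral_param_law (h : T -> R) : measurable_fun D h ->
  (\int[param_law q]_(z in D) (h z)%:E =
   \int[lebesgue_param p]_(z in D) (h z * q z)%:E)%E.
Proof.
move=> mh; rewrite param_law_density integral_mkcond integral_density//; last first.
  apply: (measurable_restrictT (EFin \o h : T -> \bar R) (@measurable_param_space R p)).1.
  exact/measurable_EFinP.
rewrite [RHS]integral_mkcond; apply: eq_integral => z _.
by rewrite !patchE; case: ifPn => _; rewrite ?mule0.
Qed.

Lemma ge0_integral_prior (Pi : probability T R) (g : T -> \bar R) :
  (forall B, measurable B -> Pi B = param_law q B) ->
  measurable_fun [set: T] g -> (forall z, 0 <= g z)%E ->
  (\int[Pi]_z g z = \int[lebesgue_param p]_(z in D) (g z * (q z)%:E))%E.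
Proof.
move=> PiE mg g0.
rewrite (eq_measure_integral (density_measure (@lebesgue_param R p) mq' q'0)).
  rewrite ge0_integral_density// [RHS]integral_mkcond; apply: eq_integral => z _.
  by rewrite !patchE; case: ifPn => _; rewrite ?mule0.
rewrite param_law_density in PiE; move=> A mA _; exact: PiE.
Qed.

End param_integral.

(** With [d = t * (m + 1)], [1 + u <= (1 + d) * (1 + u / d) <= (1 + d) * expR (u / d)], and the
    power [m + 1] of [expR (u / d)] is [expR (u / t)]. Using [m.+1] keeps [d] positive when
    [m = 0]. *)
Lemma polynomial_le_expR (R : realType) (t : R) (m : nat) : 0 < t ->
  exists2 K : R, 0 < K & forall u : R, 0 <= u -> (1 + u) ^+ m <= K * expR (u / t).
Proof.
move=> t0; pose d := t * m.+1%:R.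
have d0 : 0 < d by rewrite mulr_gt0.
exists ((1 + d) ^+ m.+1) => [|u u0]; first by rewrite exprn_gt0//; lra.
apply: (@le_trans _ _ ((1 + u) ^+ m.+1)).
  by rewrite exprS ler_peMl ?exprn_ge0//; lra.
have -> : u / t = u / d * m.+1%:R by rewrite /d invfM mulrA mulfVK ?pnatr_eq0.
have ud : 0 <= u / d by rewrite divr_ge0// ltW.
rewrite expRM_natr -exprMn lerXn2r ?nnegrE ?mulr_ge0 ?expR_ge0//; [lra|lra|].
apply: (@le_trans _ _ ((1 + d) * (1 + u / d))).
  have -> : (1 + d) * (1 + u / d) = 1 + u + (d + u / d) by field; rewrite gt_eqF.
  by rewrite lerDl addr_ge0// ltW.
by rewrite ler_wpM2l ?expR_ge1Dx//; lra.
Qed.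

Lemma sub_exponentialP d (T : measurableType d) (R : realType)
    (P : probability T R) (X : T -> R) : sub_exponential P X ->
  exists2 t : R, 0 < t & ('E_P[fun u => (expR (`|X u| / t))%R] < +oo)%E.
Proof.
rewrite /sub_exponential /psi1_norm => /ereal_inf_lt[_ [t [t0 Et] _] _].
by exists t => //; apply: le_lt_trans Et _; exact: ltry.
Qed.

Lemma measurable_scale_inv (R : realType) (p : nat) :
  measurable_fun (param_space p : set ('cV[R]_p * measurableTypeR R))
    (fun z => z.2^-1).
Proof.
apply: (eq_measurable_fun (fun z : 'cV[R]_p * measurableTypeR R => z.2 `^ (-1))).
  by move=> z /set_mem z0; rewrite powR_inv1// ltW.
apply: measurable_funTS; apply: (measurableT_comp (measurable_powR _)).
exact: measurable_snd.
Qed.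

Lemma measurable_dot (R : realType) (p : nat) (u : 'cV[R]_p) :
  measurable_fun [set: 'cV[R]_p * measurableTypeR R]
    (fun z => (u^T *m z.1) 0 0).
Proof.
under eq_fun do rewrite mxE.
apply: measurable_sum => j; apply: measurable_funM => //.
by apply: (measurableT_comp (measurable_cV_coord j)); exact: measurable_fst.
Qed.

Section dominating.
Variables (R : realType) (p : nat).
Local Notation T := ('cV[R]_p * measurableTypeR R)%type.
Local Notation D := (param_space p : set T).
Variables (Pi : probability T R) (prior : 'cV[R]_p * R -> R).
Hypothesis p_gt0 : (0 < p)%N.
Hypothesis pi_density : prior_density Pi prior.
Hypothesis A2 : prior_assumption Pi.

(** The function is at most [H] times the prior density, where [H] combines one inverse moment of
    [sigma ^ 2] with one exponential moment of each coordinate of [beta]. *)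
Lemma integrable_prior_dominating (n N : nat) : (0 < n)%N ->
  (@lebesgue_param R p).-integrable D
    (fun z => (Num.max 1 z.2^-1 ^+ n * coord_norm z.1 ^+ N * prior z)%:E).
Proof.
move=> n0; case: pi_density => mprior prior0 PiE.
case: A2 => _ inv_moments _ subexp.
have n0R : 0 < n%:R :> R by rewrite ltr0n.
(* Order [n] for [sigma ^ 2] matches the power [2 n] of [max 1 s^-1] that arises when the two
   factors are decoupled. *)
have Einv := inv_moments _ n0R.
have [t tE] := choice (fun j => (exists2P _ _).1 (sub_exponentialP (subexp j))).
have [K KE] := choice (fun j : 'I_p =>
  (exists2P _ _).1 (polynomial_le_expR (2 * N)%N (tE j).1)).
pose C : R := p.+1%:R ^+ (2 * N).
(* the power of [max 1 s^-1] and that of [coord_norm] are decoupled by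
   [a * b <= a ^ 2 + b ^ 2], so that no joint moment is needed *)
pose H (z : T) : \bar R := (1 + ((z.2 ^+ 2) `^ (- n%:R))%:E +
  \sum_j (C * K j)%:E * (expR (`|z.1 j 0| / t j))%:E)%E.
have C0 : 0 <= C by rewrite exprn_ge0.
have m2 : measurable_fun [set: T] (fun z : T => ((z.2 ^+ 2) `^ (- n%:R))%:E).
  apply/measurable_EFinP; apply: (measurableT_comp (measurable_powR _)) => //.
  by apply: measurable_funX; exact: measurable_snd.
have mexp j : measurable_fun [set: T] (fun z : T => (expR (`|z.1 j 0| / t j))%:E).
  apply/measurable_EFinP; apply: measurableT_comp => //.
  apply: measurable_funM => //; apply: measurableT_comp => //.
  by apply: (measurableT_comp (measurable_cV_coord j)); exact: measurable_fst.
have mCexp j : measurable_fun [set: T]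
    (fun z : T => (C * K j)%:E * (expR (`|z.1 j 0| / t j))%:E)%E.
  exact: measurable_funeM.
have Cexp0 j (z : T) : (0 <= (C * K j)%:E * (expR (`|z.1 j 0| / t j))%:E)%E.
  by rewrite -EFinM lee_fin !mulr_ge0 ?expR_ge0// ltW//; exact: (KE j).1.
have msum : measurable_fun [set: T]
    (fun z : T => \sum_j (C * K j)%:E * (expR (`|z.1 j 0| / t j))%:E)%E.
  exact: emeasurable_sum.
have mH : measurable_fun [set: T] H.
  by apply: emeasurable_funD => //; exact: emeasurable_funD.
have H0 z : (0 <= H z)%E.
  by rewrite /H !adde_ge0// ?lee_fin ?powR_ge0 ?sume_ge0.
have HPi : (\int[Pi]_z H z < +oo)%E.
  rewrite /H ge0_integralD//; last 3 first.
  - by move=> z _; rewrite adde_ge0// lee_fin powR_ge0.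
  - exact: emeasurable_funD.
  - by move=> z _; rewrite sume_ge0.
  rewrite ge0_integralD//; last by move=> z _; rewrite lee_fin powR_ge0.
  rewrite ge0_integral_sum//.
  apply: lte_add_pinfty.
    apply: lte_add_pinfty.
      by rewrite integral_cst//= probability_setT mule1 ltry.
    by move: Einv; rewrite unlock.
  apply: lte_sum_pinfty => j _.
  rewrite ge0_integralZl//; last first.
  - by rewrite lee_fin mulr_ge0// ltW//; exact: (KE j).1.
  apply: lte_mul_pinfty; rewrite ?lee_fin ?mulr_ge0 ?(ltW (KE j).1)//.
  by move: (tE j).2; rewrite unlock.
have mD := @measurable_param_space R p.
have mprior' : measurable_fun D (EFin \o prior) by exact/measurable_EFinP.
rewrite (ge0_integral_prior mprior prior0 PiE)// in HPi.
have iH : (@lebesgue_param R p).-integrable D (fun z => H z * (prior z)%:E)%E.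
  apply/integrableP; split.
    by apply: emeasurable_funM => //; exact: measurable_funTS.
  under eq_integral => z /set_mem Dz do rewrite gee0_abs ?mule_ge0 ?lee_fin ?prior0//.
  exact: HPi.
apply: le_integrable iH => //.
  apply/measurable_EFinP; apply: measurable_funM; last exact: mprior.
  apply: measurable_funM.
    apply: measurable_funX; apply: measurable_maxr => //.
    exact: measurable_scale_inv.
  apply: measurable_funX; apply: measurable_funD => //; apply: measurable_sum => j.
  apply: measurable_funTS; apply: measurableT_comp => //.
  by apply: (measurableT_comp (measurable_cV_coord j)); exact: measurable_fst.
move=> z Dz.
rewrite [leRHS]gee0_abs ?mule_ge0 ?lee_fin ?prior0//.
have s0 : 0 < z.2 by [].
have V0 : 0 <= Num.max 1 z.2^-1 ^+ n by rewrite exprn_ge0// le_max ler01.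
have B0 : 0 <= coord_norm z.1 ^+ N.
  by rewrite exprn_ge0// (le_trans ler01 (coord_norm_ge1 _)).
rewrite gee0_abs ?lee_fin ?mulr_ge0 ?prior0//.
rewrite EFinM lee_wpmul2r ?lee_fin ?prior0//.
rewrite /H; under eq_bigr do rewrite -EFinM.
rewrite sumEFin -!EFinD lee_fin.
have VB : Num.max 1 z.2^-1 ^+ n * coord_norm z.1 ^+ N <=
    Num.max 1 z.2^-1 ^+ (2 * n) + coord_norm z.1 ^+ (2 * N).
  by rewrite !(mulnC 2%N) !exprM; nra.
apply: le_trans VB _; apply: lerD.
  rewrite powRN powR_mulrn ?sqr_ge0// -exprM -exprVn.
  have [s1|s1] := leP 1 z.2^-1.
    by rewrite lerDr.
  by rewrite expr1n lerDl exprn_ge0// invr_ge0 ltW.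
(* The coordinate of largest absolute value controls the whole norm, so its single term in [H] is
   enough. *)
pose j := [arg max_(j > Ordinal p_gt0) `|z.1 j 0|]%O.
have jmax i : `|z.1 i 0| <= `|z.1 j 0|.
  by rewrite /j; case: arg_maxP => // k _; exact.
have Bj : coord_norm z.1 <= p.+1%:R * (1 + `|z.1 j 0|).
  rewrite /coord_norm; have : \sum_i `|z.1 i 0| <= p%:R * `|z.1 j 0|.
    apply: (@le_trans _ _ (\sum_(i < p) `|z.1 j 0|)); first exact: ler_sum.
    by rewrite sumr_const card_ord mulr_natl.
  have := normr_ge0 (z.1 j 0); rewrite -natr1; have := ler0n R p; nra.
apply: (@le_trans _ _ ((p.+1%:R * (1 + `|z.1 j 0|)) ^+ (2 * N))).
  apply: lerXn2r => //; rewrite nnegrE ?mulr_ge0 ?addr_ge0//.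
  exact: sumr_ge0.
rewrite exprMn (bigD1 j)//= -/C.
apply: (@le_trans _ _ (C * K j * expR (`|z.1 j 0| / t j))).
  by rewrite -mulrA ler_wpM2l//; exact: (KE j).2.
rewrite lerDl sumr_ge0// => i _.
by have := Cexp0 i z; rewrite -EFinM lee_fin.
Qed.

End dominating.

(** * Convergence of the posterior *)

Lemma measurable_likelihood (R : realType) (n p : nat) (x : 'I_n -> 'cV[R]_p)
    (f : R -> R) (y : 'I_n -> R) (J : {set 'I_n}) : measurable_fun [set: R] f ->
  measurable_fun (param_space p : set ('cV[R]_p * measurableTypeR R))
    (likelihood x f y J).
Proof.
move=> mf; rewrite /likelihood; under eq_fun do rewrite big_mkcond.
apply: measurable_prod => i _; case: (i \in J) => //.
have minv := @measurable_scale_inv R p.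
apply: measurable_funM => //; apply: measurableT_comp => //.
apply: measurable_funM => //; apply: measurable_funB => //.
by apply: measurable_funTS; exact: measurable_dot.
Qed.

Section normalization.
Variables (R : realType) (p : nat).
Local Notation T := ('cV[R]_p * measurableTypeR R)%type.
Local Notation D := (param_space p : set T).
Local Notation leb := (@lebesgue_param R p).

(** The constant [k] cancels in the normalization. It is the product of the outlier densities for
    the posterior and 1 for the limit, so both expectations become quotients of integrals covered by
    dominated convergence. *)
Lemma integral_normalized (q G h : 'cV[R]_p * R -> R) (k : R) : 0 < k ->
  (forall z, D z -> q z = k * G z) -> (forall z, D z -> 0 <= G z) ->
  measurable_fun D h -> leb.-integrable D (EFin \o G) ->
  leb.-integrable D (fun z => (h z * G z)%:E) ->
  (\int[param_law (normalized q)]_(z in D) (h z)%:E =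
   (fine (\int[leb]_(z in D) (h z * G z)%:E) / fine (\int[leb]_(z in D) (G z)%:E))%:E)%E.
Proof.
move=> k0 qG G0 mh iG ihG.
have mG : measurable_fun D G by apply/measurable_EFinP; exact: measurable_int iG.
have mD := @measurable_param_space R p.
have massE : fine (param_mass q) = k * fine (\int[leb]_(z in D) (G z)%:E)%E.
  rewrite /param_mass (eq_integral (fun z : T => k%:E * (G z)%:E)%E); last first.
    by move=> z /set_mem Dz; rewrite qG.
  by rewrite integralZl// fineM//; exact: integrable_fin_num.
have gE0 : 0 <= fine (\int[leb]_(z in D) (G z)%:E)%E.
  by apply: fine_ge0; apply: integral_ge0 => z Dz; rewrite lee_fin G0.
rewrite /normalized massE.
set g := fine (\int[leb]_(z in D) (G z)%:E)%E.
have nE z : D z -> q z / (k * g) = g^-1 * G z.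
  by move=> Dz; rewrite qG// invfM mulrACA mulfV ?gt_eqF// mul1r mulrC.
rewrite integral_param_law//; last 2 first.
- apply: (eq_measurable_fun (fun z : T => g^-1 * G z)).
    by move=> z /set_mem Dz; rewrite nE.
  exact: measurable_funM.
- by move=> z Dz; rewrite nE// mulr_ge0 ?invr_ge0 ?G0.
rewrite (eq_integral (fun z : T => (g^-1)%:E * (h z * G z)%:E)%E); last first.
  by move=> z /set_mem Dz; rewrite nE// -EFinM mulrCA.
rewrite integralZl// mulrC EFinM fineK//.
exact: integrable_fin_num.
Qed.

(** A vanishing mass would force [prior * r = 0], hence [prior = 0], almost everywhere,
    contradicting the total mass 1 of [Pi]. *)
Lemma param_mass_gt0 (Pi : probability T R) (prior r q : 'cV[R]_p * R -> R) :
  prior_density Pi prior -> (forall z, D z -> 0 < r z) ->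
  (forall z, D z -> q z = prior z * r z) -> measurable_fun D q ->
  (0 < param_mass q)%E.
Proof.
move=> [mprior prior0 PiE] r0 qE mq.
have mD := @measurable_param_space R p.
have mprior' : measurable_fun D (EFin \o prior) by exact/measurable_EFinP.
have mq' : measurable_fun D (EFin \o q) by exact/measurable_EFinP.
have q0 z : D z -> 0 <= q z by move=> Dz; rewrite qE// mulr_ge0 ?prior0// ltW// r0.
rewrite lt_def; apply/andP; split; last first.
  by apply: integral_ge0 => z Dz; rewrite lee_fin q0.
apply/negP => /eqP qint0.
have : (\int[leb]_(z in D) (prior z)%:E = 0)%E.
  have qabs : (\int[leb]_(z in D) `|(EFin \o q) z| = 0)%E.
    rewrite -[RHS]qint0; apply: eq_integral => z /set_mem Dz.
    by rewrite gee0_abs// lee_fin q0.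
  have qae := (ae_eq_integral_abs leb mD mq').1 qabs.
  have : ae_eq leb D (EFin \o prior) (cst 0%E).
    apply: filterS qae => z + Dz => /(_ Dz) /= [] /eqP; rewrite qE// mulf_eq0.
    by rewrite (gt_eqF (r0 _ Dz)) orbF => /eqP ->.
  move=> /(ae_eq_integral_abs leb mD mprior').2 /= pabs.
  rewrite -[RHS]pabs; apply: eq_integral => z /set_mem Dz.
  by rewrite ger0_norm ?prior0.
have := PiE _ (@measurableT _ T).
rewrite probability_setT /param_law setTI => <- /eqP.
by rewrite onee_eq0.
Qed.

End normalization.

(** The first two conclusions say that the masses are positive and finite, so that [fine] and
    [normalized] have their intended meaning in the other three. *)
Theorem mainTheorem2 (R : realType) (n p : nat) (n_gt0 : (0 < n)%N)
    (p_gt0 : (0 < p)%N) (x : 'I_n -> 'cV[R]_p) (f : R -> R) (c : tail_case)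
    (alpha : R) (Pi : probability ('cV[R]_p * measurableTypeR R)%type R)
    (prior : 'cV[R]_p * R -> R) (sgn : 'I_n -> bool) (a b : 'I_n -> R)
    (f_density : is_density f) (pi_density : prior_density Pi prior)
    (a_gt0 : forall i, 0 < a i) (b_values : forall i, b i = 0 \/ 1 <= b i)
    (A1 : error_assumption f c alpha) (A2 : prior_assumption Pi)
    (A3 : outlier_proportion c alpha (outliers b)) :
  let out := outliers b in
  let y := response sgn a b in
  let post w := posterior_kernel x f prior (y w) in
  let post_lim := limit_kernel x f prior c alpha out (fixed_response sgn a) in
  [/\ forall w, 0 < w -> (0 < param_mass (post w) < +oo)%E,
      (0 < param_mass post_lim < +oo)%E,
      fine (param_mass (post w)) / (\prod_(i in out) f (y w i)) @[w --> +oo] -->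
        fine (param_mass post_lim),
      (forall (beta : 'cV[R]_p) (sigma : R), 0 < sigma ->
        normalized (post w) (beta, sigma) @[w --> +oo] -->
        normalized post_lim (beta, sigma)) &
      cvg_in_distribution (fun w => param_law (normalized (post w)))
        (param_law (normalized post_lim))].
Proof.
move=> out y post post_lim.
pose T := ('cV[R]_p * measurableTypeR R)%type.
pose D := (param_space p : set T).
pose leb := @lebesgue_param R p.
have mD : measurable D := @measurable_param_space R p.
have [mf _ _] := f_density.
have [mprior prior0 PiE] := pi_density.
have f_gt0 v : 0 < f v by case: A1 => /(_ v)[].
have [C C0 fC] : exists2 C : R, 0 < C & forall v, f v <= C by case: A1.
(* [post w = P w * F w]: the factor [P w] does not depend on the parameters, and [F w] is the part
   with a pointwise limit. *)
pose F w z := prior z * likelihood_ratio x f sgn a b w z.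
pose P w := \prod_(i in out) f (y w i).
have P0 w : 0 < P w by apply: prodr_gt0.
have postE w z : post w z = P w * F w z.
  rewrite /F /likelihood_ratio -/(P w) /post /posterior_kernel.
  by field; rewrite gt_eqF.
have mlik Y J := @measurable_likelihood R n p x f Y J mf.
have mpost w : measurable_fun D (post w) by exact: measurable_funM.
have mF w : measurable_fun D (F w).
  by apply: measurable_funM => //; apply: measurable_funM.
have lik_gt0 Y J (z : 'cV[R]_p * R) : 0 < z.2 -> 0 < likelihood x f Y J z.
  by move=> z0; apply: prodr_gt0 => i _; rewrite mulr_gt0 ?invr_gt0.
have ratio_gt0 w (z : 'cV[R]_p * R) : 0 < z.2 -> 0 < likelihood_ratio x f sgn a b w z.
  by move=> z0; rewrite divr_gt0// ?lik_gt0// P0.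
have F0 w z : D z -> 0 <= F w z.
  by move=> Dz; rewrite mulr_ge0 ?prior0// ltW// ratio_gt0.
have FL z : D z -> F w z @[w --> +oo] --> post_lim z.
  move=> Dz; rewrite /post_lim /limit_kernel -mulrA.
  by apply: cvgM; [exact: cvg_cst|exact: cvg_likelihood_ratio].
have L0 z : D z -> 0 <= post_lim z.
  move=> Dz; rewrite /post_lim /limit_kernel -mulrA mulr_ge0 ?prior0//.
  rewrite mulr_ge0 ?(ltW (lik_gt0 _ _ _ _))// exprn_ge0//.
  by rewrite /outlier_weight; case: (c) => //; exact: powR_ge0.
have [K [w0 [N Fbound]]] :=
  likelihood_ratio_bound x sgn A1 b_values a_gt0 A3.
pose g z := Num.max 1 z.2^-1 ^+ n * coord_norm z.1 ^+ N * prior z.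
have ig : leb.-integrable D (EFin \o g).
  exact: (integrable_prior_dominating p_gt0 pi_density A2 N n_gt0).
pose w1 := Num.max w0 0.
have ihg (k : R) : leb.-integrable D (EFin \o (fun z => k * K * g z)).
  exact: (integrableZl mD (k * K) ig).
have hFg (h : 'cV[R]_p * R -> R) (M : R) :
    (forall z, param_space p z -> `|h z| <= M) ->
  forall w z, w1 <= w -> D z -> `|h z * F w z| <= M * K * g z.
  move=> hM w z; rewrite ge_max => /andP[ww _] Dz.
  have /andP[r0 rK] := Fbound w z ww Dz.
  rewrite normrM (ger0_norm (F0 w z Dz)) /g -mulrA ler_pM ?F0 ?hM//.
  by rewrite mulrA [leRHS]mulrC /F ler_wpM2l ?prior0.
have hFcvg (h : 'cV[R]_p * R -> R) z : D z ->
    h z * F w z @[w --> +oo] --> h z * post_lim z.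
  by move=> Dz; apply: cvgM; [exact: cvg_cst|exact: FL].
have mhF (h : 'cV[R]_p * R -> R) w : measurable_fun D h ->
    measurable_fun D (fun z => h z * F w z).
  by move=> mh; exact: measurable_funM.
(* One dominated convergence with a bounded weight [h]: [h = 1] gives the masses, and a continuous
   [h] gives convergence in distribution. *)
have dct (h : 'cV[R]_p * R -> R) (M : R) : measurable_fun D h ->
    (forall z, param_space p z -> `|h z| <= M) ->
  [/\ forall w, w1 <= w -> leb.-integrable D (fun z => (h z * F w z)%:E),
      leb.-integrable D (fun z => (h z * post_lim z)%:E) &
      fine (\int[leb]_(z in D) (h z * F w z)%:E)%E @[w --> +oo] -->
      fine (\int[leb]_(z in D) (h z * post_lim z)%:E)%E].
  move=> mh hM; split.
  - move=> w ww; exact: (integrable_dominated mD (fun w => mhF h w mh) (ihg M)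
      (hFg h M hM) ww).
  - exact: (integrable_dominated_limit mD (fun w => mhF h w mh) (hFcvg h)
      (ihg M) (hFg h M hM)).
  - exact: (dominated_cvg_pinfty mD (fun w => mhF h w mh) (hFcvg h)
      (ihg M) (hFg h M hM)).
have [iF iL cvgF] : [/\ forall w, w1 <= w -> leb.-integrable D (EFin \o F w),
    leb.-integrable D (EFin \o post_lim) &
    fine (\int[leb]_(z in D) (F w z)%:E)%E @[w --> +oo] -->
    fine (\int[leb]_(z in D) (post_lim z)%:E)%E].
  have one_mul (G : T -> R) : (fun z => (1 * G z)%:E) = EFin \o G.
    by apply/funext => z; rewrite mul1r.
  have [||h1 h2 h3] := dct (cst 1) 1.
  - exact: measurable_cst.
  - by move=> z _; rewrite normr1.
  split; [move=> w /h1| |]; rewrite -?one_mul//.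
  by move: h3; under eq_fun do rewrite one_mul; rewrite one_mul.
have mass_postE w : w1 <= w ->
    fine (param_mass (post w)) = P w * fine (\int[leb]_(z in D) (F w z)%:E)%E.
  move=> ww; rewrite /param_mass (eq_integral (fun z : T => (P w)%:E * (F w z)%:E)%E).
    by rewrite integralZl ?iF// fineM//; apply: integrable_fin_num => //; exact: iF.
  by move=> z _; rewrite postE.
have mpost_lim : measurable_fun D post_lim.
  by apply/measurable_EFinP; exact: measurable_int iL.
have lim_gt0 : (0 < param_mass post_lim)%E.
  apply: (param_mass_gt0 pi_density (r := fun z =>
    outlier_weight c alpha z.2 ^+ #|out| *
    likelihood x f (fixed_response sgn a) (~: out) z)) => //.
    move=> z Dz; rewrite mulr_gt0 ?lik_gt0// exprn_gt0//.
    by rewrite /outlier_weight; case: (c) => //; exact: powR_gt0.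
  by move=> z _; rewrite /post_lim /limit_kernel mulrA.
have lim_fin : param_mass post_lim \is a fin_num by exact: integrable_fin_num.
have lim_neq0 : fine (param_mass post_lim) != 0.
  by rewrite gt_eqF// fine_gt0// lim_gt0 ltey_eq lim_fin.
have near_w1 : \forall w \near +oo, w1 <= w.
  by apply: nbhs_pinfty_ge; exact: num_real.
have mass_cvg : fine (param_mass (post w)) / P w @[w --> +oo] -->
    fine (param_mass post_lim).
  apply: cvg_trans cvgF; apply: near_eq_cvg; near=> w.
  rewrite mass_postE; last by near: w.
  by rewrite mulrAC mulfV ?mul1r// gt_eqF.
split => //.
- move=> w wpos; apply/andP; split.
    apply: (param_mass_gt0 pi_density (r := likelihood x f (y w) [set: 'I_n]%SET)) => //.
    by move=> z Dz; exact: lik_gt0.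
  (* For every [w > 0], not only large ones, [f <= C] bounds the likelihood by
     [(C * max 1 s^-1) ^+ n]; no power of the norm of [beta] appears, hence the exponent 0. *)
  have ipost : leb.-integrable D (EFin \o post w).
    have ig0 := integrable_prior_dominating p_gt0 pi_density A2 0 n_gt0.
    apply: le_integrable (integrableZl mD (C ^+ n) ig0) => //.
      exact/measurable_EFinP.
    move=> z Dz /=; rewrite lee_fin ger0_norm; last first.
      by rewrite mulr_ge0 ?prior0//; apply: ltW; exact: lik_gt0.
    apply: le_trans (_ : _ <= _) (ler_norm _); rewrite expr0 mulr1 mulrA.
    rewrite /post /posterior_kernel mulrC.
    rewrite ler_wpM2r ?prior0// -exprMn /likelihood.
    rewrite (eq_bigl predT); last by move=> i; rewrite finset.inE.
    rewrite -[X in _ <= _ ^+ X](card_ord n) -prodr_const; apply: ler_prod => i _.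
    rewrite mulr_ge0 ?invr_ge0 ?(ltW (f_gt0 _)) ?(ltW Dz)//= mulrC.
    by rewrite ler_pM ?invr_ge0 ?(ltW (f_gt0 _)) ?(ltW Dz)// le_max lexx orbT.
  by have := integrable_fin_num mD ipost; rewrite fin_numE ltey => /andP[].
- by rewrite lim_gt0 ltey_eq lim_fin.
- move=> beta sigma sigma0; rewrite /normalized.
  (* Kernel and mass are both divided by [P w], after which each converges and the limiting mass is
     nonzero. *)
  have cvgq : F w (beta, sigma) / (fine (param_mass (post w)) / P w) @[w --> +oo] -->
      post_lim (beta, sigma) / fine (param_mass post_lim).
    by apply: cvgM; [exact: FL|exact: cvgV].
  apply: cvg_trans cvgq; apply: near_eq_cvg; near=> w.
  by rewrite postE invfM invrK mulrA mulrAC [P w * _]mulrC.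
- move=> h hcont [M hM].
  have mh : measurable_fun D h by exact: within_continuous_measurable_param.
  have [ihF ihL cvghF] := dct h M mh hM.
  have intL := integral_normalized ltr01 (fun z _ => esym (mul1r (post_lim z))) L0
    mh iL ihL.
  have cvgq : (fine (\int[leb]_(z in D) (h z * F w z)%:E)%E /
        fine (\int[leb]_(z in D) (F w z)%:E)%E)%:E @[w --> +oo] -->
      (fine (\int[leb]_(z in D) (h z * post_lim z)%:E)%E /
        fine (\int[leb]_(z in D) (post_lim z)%:E)%E)%:E.
    apply: cvg_EFin; first exact: nearW.
    by apply: cvgM => //; exact: cvgV.
  rewrite -intL in cvgq.
  apply: cvg_trans cvgq; apply: near_eq_cvg; near=> w.
  have ww : w1 <= w by near: w.
  apply/esym.
  exact: (integral_normalized (P0 w) (fun z _ => postE w z) (F0 w) mh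
    (iF w ww) (ihF w ww)).
Unshelve. all: by end_near. Qed.
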